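(* Let $D\subset\mathbb{R}^d$ ($d\ge 2$) be a bounded convex domain with $C^1$ boundary $\Gamma$, and fix $T>0$. For any integer $N\ge1$ and $\Delta t>0$ with $N\Delta t\le T$, the solution $\sigma$ of the forward Euler scheme for the Dirichlet problem for the heat equation on $D$ (defined in the context) with data $f$ satisfies $$\|\sigma\|_\infty\;\le\;\frac{1}{\frac12-C(T)}\,\|f\|_\infty ,$$ where $$C(T)=\sup_{\mathbf{x}\in\Gamma}\int_0^T\int_\Gamma\left|\frac{\partial G(\mathbf{x}-\mathbf{y},T-\tau)}{\partial\bm{\nu}(\mathbf{y})}\right|dS(\mathbf{y})\,d\tau .$$ In other words, the forward Euler scheme is unconditionally stable on $[0,T]$ for any $T>0$.
   Context: $G(\mathbf{x},t)=(4\pi t)^{-d/2}e^{-|\mathbf{x}|^2/(4t)}$ is the heat kernel on $\mathbb{R}^d$, $\bm{\nu}(\mathbf{y})$ is the outward unit normal at $\mathbf{y}\in\Gamma$, and $$\frac{\partial G(\mathbf{x}-\mathbf{y},t)}{\partial\bm{\nu}(\mathbf{y})}=\frac{(\mathbf{x}-\mathbf{y})\cdot\bm{\nu}(\mathbf{y})}{2^{d+1}\pi^{d/2}t^{1+d/2}}\,e^{-\frac{|\mathbf{x}-\mathbf{y}|^2}{4t}} .$$ Given $f(\cdot,n\Delta t)\in L^\infty(\Gamma)$, $n=0,\dots,N$, with $f(\cdot,0)\equiv0$, the forward Euler scheme (for the double-layer equation $(-\tfrac12+\mathcal{D})[\sigma]=f$) sets $\sigma(\cdot,0)\equiv0$ and,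 for $n=1,\dots,N$, $$\tfrac12\sigma(\mathbf{x},n\Delta t)=\sum_{j=0}^{n-1}\int_{j\Delta t}^{(j+1)\Delta t}\int_\Gamma\frac{\partial G(\mathbf{x}-\mathbf{y},n\Delta t-\tau)}{\partial\bm{\nu}(\mathbf{y})}\,\sigma(\mathbf{y},j\Delta t)\,ds(\mathbf{y})\,d\tau-f(\mathbf{x},n\Delta t).$$ $\|\cdot\|_\infty$ denotes the $L^\infty$ norm over $\Gamma$ in space and the $\ell^\infty$ norm over $n=0,\dots,N$ in the discrete time variable. *)

(* Defs.v *)
From HB Require Import structures.
From mathcomp Require Import all_boot all_order all_algebra.
From mathcomp Require Import all_classical all_reals all_analysis.

Set Implicit Arguments.
Unset Strict Implicit.
Unset Printing Implicit Defensive.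

Import Order.TTheory GRing.Theory Num.Theory.
Import numFieldNormedType.Exports.

Local Open Scope classical_set_scope.
Local Open Scope ring_scope.

(* The library norm on 'rV[R]_d is the max norm: it gives the right topology and
   the right bounded sets, but |x|^2 in formulas must be the Euclidean one. *)
Definition dot (R : realType) (d : nat) (u v : 'rV[R]_d) : R :=
  \sum_(k < d) u 0 k * v 0 k.

Notation borel_rV R d := (g_sigma_algebraType (@open 'rV[R]_d)).

Definition bdry (R : realType) (d : nat) (D : set 'rV[R]_d) : set 'rV[R]_d :=
  closure D `\` interior D.

(* The point whose i-th coordinate is a and whose other coordinates are, in
   order, those of z; it is inverse to y |-> (y 0 i, col' i y). *)
Definition insert_coord (R : realType) (d : nat) (i : 'I_d) (a : R)
    (z : 'rV[R]_d.-1) : 'rV[R]_d :=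
  \row_k (if unlift i k is Some j then z 0 j else a).

(* Lebesgue integral over R^m, written by Tonelli as an iterated integral; it is
   only applied to nonnegative Borel functions. *)
Fixpoint integral_rV (R : realType) (m : nat) : ('rV[R]_m -> \bar R) -> \bar R :=
  match m with
  | 0%N => fun g => g 0
  | m'.+1 => fun g =>
      (\int[@lebesgue_measure R]_t
         integral_rV (fun z : 'rV[R]_m' => g (@insert_coord R m'.+1 ord0 t z)))%E
  end.

Definition grad (R : realType) (m : nat) (phi : 'rV[R]_m -> R) (z : 'rV[R]_m) :
    'rV[R]_m :=
  \row_j 'D_(delta_mx 0 j) phi z.

Definition C1_fun (R : realType) (m : nat) (phi : 'rV[R]_m -> R) : Prop :=
  (forall z, differentiable phi z) /\ continuous (grad phi).

(* Inside the open set U, D is the strict hypograph (s = false) or the strict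
   epigraph (s = true) of a C^1 function phi of the coordinates other than i. *)
Definition C1_chart (R : realType) (d : nat) (D U : set 'rV[R]_d) (i : 'I_d)
    (s : bool) (phi : 'rV[R]_d.-1 -> R) : Prop :=
  [/\ open U, C1_fun phi &
      forall y, U y -> (D y <-> (-1) ^+ s * (y 0 i - phi (col' i y)) < 0)].

Definition C1_boundary (R : realType) (d : nat) (D : set 'rV[R]_d) : Prop :=
  forall x, bdry D x ->
    exists (U : set 'rV[R]_d) (i : 'I_d) (s : bool) (phi : 'rV[R]_d.-1 -> R),
      U x /\ C1_chart D U i s phi.

Definition area_density (R : realType) (m : nat) (phi : 'rV[R]_m -> R)
    (z : 'rV[R]_m) : R :=
  Num.sqrt (1 + dot (grad phi z) (grad phi z)).

(* In a chart the outward normal is proportional to +-(1, - grad phi), with the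
   entry 1 in coordinate i.  The values of nu off the boundary are irrelevant. *)
Definition outward_unit_normal (R : realType) (d : nat) (D : set 'rV[R]_d)
    (nu : 'rV[R]_d -> 'rV[R]_d) : Prop :=
  forall (U : set 'rV[R]_d) (i : 'I_d) (s : bool) (phi : 'rV[R]_d.-1 -> R),
    C1_chart D U i s phi ->
    forall y, bdry D y -> U y ->
      nu y = ((-1) ^+ s / area_density phi (col' i y)) *:
               insert_coord i 1 (- grad phi (col' i y)).

(* The surface measure ds of the boundary, as a Borel measure on R^d carried by
   the boundary; the chart formula determines it when the boundary is C^1. *)
Definition surface_measure (R : realType) (d : nat) (D : set 'rV[R]_d)
    (S : {measure set (borel_rV R d) -> \bar R}) : Prop :=
  S (~` bdry D) = 0%E /\
  forall (U : set 'rV[R]_d) (i : 'I_d) (s : bool) (phi : 'rV[R]_d.-1 -> R),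
    C1_chart D U i s phi ->
    forall A : set (borel_rV R d), measurable A -> A `<=` bdry D `&` U ->
      S A = integral_rV (fun z =>
        (\1_A (insert_coord i (phi z) z) * area_density phi z)%:E).

(* Normal derivative, in y, of the heat kernel G(x - y, t). *)
Definition dG_dnu (R : realType) (d : nat) (nu : 'rV[R]_d -> 'rV[R]_d)
    (x y : 'rV[R]_d) (t : R) : R :=
  dot (x - y) (nu y)
    / (2 ^+ d.+1 * pi `^ (d%:R / 2) * t `^ (1 + d%:R / 2))
  * expR (- (dot (x - y) (x - y) / (4 * t))).

Definition C_const (R : realType) (d : nat) (D : set 'rV[R]_d)
    (nu : 'rV[R]_d -> 'rV[R]_d) (S : {measure set (borel_rV R d) -> \bar R})
    (T : R) : \bar R :=
  ereal_sup [set (\int[@lebesgue_measure R]_(tau in `[0%R, T])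
                    \int[S]_(y in (bdry D : set (borel_rV R d)))
                      `|dG_dnu nu x y (T - tau)|%:E)%E | x in bdry D].

Definition Linfty_on (R : realType) (d : nat) (D : set 'rV[R]_d)
    (S : {measure set (borel_rV R d) -> \bar R}) (g : 'rV[R]_d -> R) : Prop :=
  measurable_fun (bdry D : set (borel_rV R d)) (g : borel_rV R d -> R) /\
  (Lnorm S +oo (EFin \o g) < +oo)%E.

Definition norm_infty (R : realType) (d : nat)
    (S : {measure set (borel_rV R d) -> \bar R}) (N : nat)
    (u : nat -> 'rV[R]_d -> R) : \bar R :=
  \big[maxe/0%E]_(n < N.+1) Lnorm S +oo (EFin \o u n).

(* u n stands for u(., n * dt).  Functions on the boundary are taken up to
   S-negligible sets, as elements of L^infty; essential boundedness of sigma is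
   not part of the definition. *)
Definition euler_solution (R : realType) (d : nat) (D : set 'rV[R]_d)
    (nu : 'rV[R]_d -> 'rV[R]_d) (S : {measure set (borel_rV R d) -> \bar R})
    (N : nat) (dt : R) (f sigma : nat -> 'rV[R]_d -> R) : Prop :=
  [/\ forall n, (n <= N)%N ->
        measurable_fun (bdry D : set (borel_rV R d)) (sigma n : borel_rV R d -> R),
      {ae S, forall x, bdry D x -> sigma 0%N x = 0} &
      forall n, (1 <= n <= N)%N ->
        {ae S, forall x, bdry D x ->
           (2^-1 * sigma n x)%:E =
           (\sum_(j < n)
              \int[@lebesgue_measure R]_(tau in
                     `[(j%:R * dt)%R, (j.+1%:R * dt)%R])
                \int[S]_(y in (bdry D : set (borel_rV R d)))
                  (dG_dnu nu x y (n%:R * dt - tau) * sigma j y)%:E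
            - (f n x)%:E)%E}].

(* Main.v *)
(** Proof idea.  Fix x on the boundary and let g be the heat kernel at time 1.
    Integrating the normal derivative of the heat kernel over the time interval
    and substituting l = (T - tau)^(-1/2) gives
      int_0^T |dG/dnu(y)| dtau = ((y - x).nu(y)) int_(l >= T^(-1/2)) g(l(y - x)) l^(d-1) dl,
    and l^(d-1) (y - x).nu(y) is the Jacobian of the map (y, l) |-> l(y - x) from
    the boundary times (0, oo) to R^d.  By convexity this map is injective where
    (y - x).nu(y) > 0, with values in the open cone C spanned by D - x, and l is
    recovered from l(y - x) as the Minkowski gauge of D - x.  Hence
      int_0^T int |dG/dnu| <= int_C g - int_(T^(-1/2) (D - x)) g.
    Since C and -C are disjoint, int_C g <= 1/2 int g = 1/2, while the last
    integral is bounded below uniformly in x; this gives C(T) < 1/2, and the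
    stability bound follows by induction on the time step.  Only the inequality in
    the change of variables is needed: Tonelli and a scaling reduce it, chart by
    chart, to the one-dimensional lemma [area_inequality]. *)
Require Import Defs.
From HB Require Import structures.
From mathcomp Require Import all_boot all_order all_algebra.
From mathcomp Require Import all_classical all_reals all_analysis.
From mathcomp Require Import measurable_realfun ess_sup_inf.
From mathcomp Require Import ring lra.
Import Order.TTheory GRing.Theory Num.Theory.
Import numFieldNormedType.Exports.
Local Open Scope classical_set_scope.
Local Open Scope ring_scope.
Set Implicit Arguments.
Unset Strict Implicit.
Unset Printing Implicit Defensive.

(** * Borel functions with values in R^m *)

(** In a chart y = (phi z, z) the surface density cancels the denominator of the normal, so (y -
    x).nu ds becomes, up to sign, Q(z) dz with Q(z) = phi z - x_i - grad phi(z).(z - x'), where x'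
    is x without its i-th coordinate. For fixed l, the scaling z = x' + w/l turns l^(d-1) dz into
    dw, and l(y - x) into the vector with i-th coordinate q_w(l) = l (phi(x' + w/l) - x_i) and
    remaining coordinates w. The derivative of q_w in l is exactly Q(x' + w/l). Hence no determinant
    is ever computed: for each w one compares two integrals along a line parallel to axis i, where
    the gauge is a measurable left inverse of q_w. The exit point of v in the cone tells which piece
    of the boundary v comes from, so the inequalities of the separate charts add up without overlap.
    Strictness has to survive the supremum over x: the mass cut out of the cone has a lower bound
    common to all x, because the volume of a dilate of D - x does not depend on x and the dilates
    stay in a fixed ball. *)

Lemma measurable_bigcup_countType d (T : measurableType d) (I : countType)
    (P : set I) (F : I -> set T) :
  (forall i, P i -> measurable (F i)) -> measurable (\bigcup_(i in P) F i).
Proof.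
move=> mF.
have -> : \bigcup_(i in P) F i =
    \bigcup_n (if unpickle n is Some i then [set x | P i /\ F i x] else set0).
  apply/seteqP; split => [x [i Pi Fi]|x [n _]].
    by exists (pickle i) => //; rewrite pickleK.
  by case: (unpickle n) => // i [Pi Fi]; exists i.
apply: bigcup_measurable => n _; case: (unpickle n) => // i.
have [Pi|nPi] := pselect (P i).
  by rewrite (_ : [set x | _] = F i); [exact: mF|apply/seteqP; split => x //= []].
by rewrite (_ : [set x | _] = set0)//; apply/seteqP; split => x //= [].
Qed.

Lemma rV_ball_coordP (R : realType) m (x y : 'rV[R]_m) e : 0 < e ->
  ball x e y <-> forall k, `|x 0 k - y 0 k| < e.
Proof.
move=> e0; split => [[_ xy] k|xy]; first exact: xy.
by split => // i j; rewrite ord1; exact: xy.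
Qed.

(** Boxes with rational centre and radius 1/(n+1) form a countable base. This makes the Borel sets
    of R^m accessible coordinate by coordinate in [measurable_fun_rV]. *)
Lemma open_rV_bigcup (R : realType) m (O : set 'rV[R]_m) : open O ->
  O = \bigcup_(p in [set p : 'rV[rat]_m * nat |
         ball (map_mx ratr p.1 : 'rV[R]_m) p.2.+1%:R^-1 `<=` O])
      ball (map_mx ratr p.1 : 'rV[R]_m) p.2.+1%:R^-1.
Proof.
move=> oO; apply/seteqP; split => [x Ox|x [p /= pO px]]; last exact: pO.
have /nbhs_ballP[e /= e0 eO] : nbhs x O by exact: open_nbhs_nbhs.
have [n ne] : exists n, n.+1%:R^-1 < e / 2.
  have /ltr_add_invr : 0 < e / 2 by rewrite divr_gt0.
  by move=> [n]; rewrite add0r => ?; exists n.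
have n0 : 0 < n.+1%:R^-1 :> R by rewrite invr_gt0.
have /choice[c cP] : forall k : 'I_m, exists q : rat, `|ratr q - x 0 k| < n.+1%:R^-1.
  move=> k; have : x 0 k - n.+1%:R^-1 < x 0 k + n.+1%:R^-1.
    by rewrite ltrBlDr -addrA ltrDl addr_gt0.
  move=> /rat_in_itvoo[q]; rewrite in_itv/= => /andP[q1 q2].
  by exists q; rewrite ltr_distl q1.
exists (\row_k c k, n) => /=; last by apply/rV_ball_coordP => // k; rewrite !mxE.
move=> y /rV_ball_coordP -/(_ n0) cy; apply: eO; apply/rV_ball_coordP => // k.
have := cy k; have := cP k; rewrite !mxE => h1 h2.
rewrite (_ : _ - _ = (ratr (c k) - y 0 k) - (ratr (c k) - x 0 k)); last by ring.
rewrite (le_lt_trans (ler_normB _ _))// (splitr e) ltrD//.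
  exact: lt_trans ne.
exact: lt_trans ne.
Qed.

Lemma measurable_rV_open (R : realType) m (O : set 'rV[R]_m) : open O ->
  measurable (O : set (borel_rV R m)).
Proof. by move=> oO; exact: sub_sigma_algebra. Qed.

Lemma measurable_rV_closed (R : realType) m (O : set 'rV[R]_m) : closed O ->
  measurable (O : set (borel_rV R m)).
Proof.
move=> cO; rewrite -(setCK O); apply: measurableC.
by apply: measurable_rV_open; exact: closed_openC.
Qed.

(** The preimage of an open set is a countable union of preimages of boxes, and a box is a finite
    intersection of conditions on single coordinates. *)
Lemma measurable_fun_rV d (T : measurableType d) (R : realType) m
    (f : T -> borel_rV R m) :
  (forall k, measurable_fun setT (fun t => (f t : 'rV[R]_m) 0 k)) ->
  measurable_fun setT f.
Proof.
move=> mf; apply: (@measurability _ _ _ _ setT f (@open 'rV[R]_m) erefl).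
move=> _ [V oV <-]; rewrite setTI (open_rV_bigcup oV) preimage_bigcup.
apply: measurable_bigcup_countType => -[c n] _ /=.
rewrite (_ : _ @^-1` _ = \bigcap_(k in [set: 'I_m])
   ((fun t => (f t : 'rV[R]_m) 0 k) @^-1`
     `](ratr (c 0 k) - n.+1%:R^-1), (ratr (c 0 k) + n.+1%:R^-1)[)).
  rewrite -[X in measurable X]setCK setC_bigcap; apply: measurableC.
  apply: measurable_bigcup_countType => k _; apply: measurableC.
  by rewrite -[X in measurable X]setTI; exact: mf.
apply/seteqP; split => t /=.
  move=> /rV_ball_coordP; rewrite invr_gt0 ltr0n => /(_ isT) h k _.
  by have := h k; rewrite /= mxE distrC ltr_distl in_itv.
move=> h; apply/rV_ball_coordP => // k; rewrite mxE.
by have := h k I; rewrite /= in_itv/= distrC ltr_distl.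
Qed.

Lemma measurable_rV_continuous (R : realType) m n (f : 'rV[R]_m -> 'rV[R]_n) :
  continuous f -> measurable_fun setT (f : borel_rV R m -> borel_rV R n).
Proof.
move=> /continuousP cf.
apply: (@measurability _ _ (borel_rV R m) (borel_rV R n) setT f (@open 'rV[R]_n) erefl) => //.
by move=> _ [V oV <-]; rewrite setTI; apply: measurable_rV_open; exact: cf.
Qed.

Lemma measurable_rV_continuous_real (R : realType) m (f : 'rV[R]_m -> R) :
  continuous f -> measurable_fun setT (f : borel_rV R m -> R).
Proof.
move=> /continuousP cf; apply: (measurability _ (RGenOpens.measurableE R)).
by move=> _ [V [x [y ->]] <-]; rewrite setTI; apply: measurable_rV_open; exact: cf.
Qed.

Lemma measurable_coord (R : realType) m (k : 'I_m) :
  measurable_fun setT (fun v : borel_rV R m => (v : 'rV[R]_m) 0 k).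
Proof. by apply: measurable_rV_continuous_real; exact: coord_continuous. Qed.

Lemma measurable_insert_coord (R : realType) m (i : 'I_m.+1) d
    (T : measurableType d) (f : T -> R) (g : T -> borel_rV R m) :
  measurable_fun setT f -> measurable_fun setT g ->
  measurable_fun setT (fun t => insert_coord i (f t) (g t) : borel_rV R m.+1).
Proof.
move=> mf mg; apply: measurable_fun_rV => k.
rewrite (_ : (fun t => _) = fun t =>
  if unlift i k is Some j then (g t : 'rV[R]_m) 0 j else f t).
  by case: (unlift i k) => // j; exact: (measurableT_comp (measurable_coord j) mg).
by apply/funext => t; rewrite mxE.
Qed.

(** * Lebesgue measure on R^m *)

(** Serves as the exhausting sequence in proofs of sigma-finiteness. *)
Definition cube (R : realType) m (n : nat) : set (borel_rV R m) :=
  [set v | forall k, `|(v : 'rV[R]_m) 0 k| <= n%:R].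
Arguments cube : clear implicits.

Lemma measurable_cube (R : realType) m n : measurable (cube R m n).
Proof.
rewrite (_ : cube R m n =
    \bigcap_(k in [set: 'I_m]) ((fun v => (v : 'rV[R]_m) 0 k) @^-1` `[- n%:R, n%:R])).
  rewrite -[X in measurable X]setCK setC_bigcap; apply: measurableC.
  apply: measurable_bigcup_countType => k _; apply: measurableC.
  by rewrite -[X in measurable X]setTI; exact: measurable_coord.
apply/seteqP; split => v /= h k; first by move=> _; rewrite /= in_itv/= -ler_norml.
by have := h k I; rewrite /= in_itv/= -ler_norml.
Qed.

Lemma bigcup_cube (R : realType) m : \bigcup_n cube R m n = setT.
Proof.
apply/seteqP; split => // v _.
exists (Num.truncn `|v : 'rV[R]_m|).+1 => //= k.
apply: (@le_trans _ _ `|v : 'rV[R]_m|); last exact/ltW/truncnS_gt.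
by rewrite [leRHS]/Num.Def.normr /= mx_normrE; apply/bigmax_geP; right => /=; exists (ord0, k).
Qed.

(** Tonelli's theorem asks for a measure bundled with its sigma-finiteness. The equality of set
    functions lets integrals be rewritten back and forth between [mu] and the bundled copy. *)
Lemma sigma_finite_measure_pack d (T : measurableType d) (R : realType)
    (mu : {measure set T -> \bar R}) : sigma_finite setT mu ->
  exists nu : {sigma_finite_measure set T -> \bar R}, (nu : set _ -> _) = mu.
Proof.
move=> sf.
pose x := @isSFinite.Build _ _ _ (Measure.sort mu) (sfinite_measure_sigma_finite sf).
pose y := @isSigmaFinite.Build _ _ _ (Measure.sort mu) sf.
by exists (HB.pack_for {sigma_finite_measure set T -> \bar R} (Measure.sort mu) x y).
Qed.

Lemma sigma_finite_measure_of_cubes (R : realType) m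
    (mu : {measure set (borel_rV R m) -> \bar R}) :
  (forall n, mu (cube R m n) < +oo)%E ->
  exists nu : {sigma_finite_measure set (borel_rV R m) -> \bar R},
    (nu : set _ -> _) = (mu : set _ -> _).
Proof.
move=> mu_fin; apply: sigma_finite_measure_pack.
by exists (cube R m); [rewrite bigcup_cube|move=> n; split => //; exact: measurable_cube].
Qed.

Lemma insert_coord_cube (R : realType) m n a (z : 'rV[R]_m) :
  cube R m.+1 n (insert_coord ord0 a z) <-> `|a| <= n%:R /\ cube R m n z.
Proof.
split=> [h|[ha hz] k].
  split; first by have := h ord0; rewrite mxE unlift_none.
  by move=> k; have := h (lift ord0 k); rewrite mxE liftK.
by rewrite mxE; case: unliftP.
Qed.

(** [integral_rV] is an iterated integral with no measure behind it; monotone convergence, Tonelli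
    and null sets require one. It is built by induction: a Dirac mass in dimension 0, then the image
    of a product measure under insertion of coordinate 0. *)
Lemma lebesgue_rV_exists (R : realType) m :
  exists mu : {sigma_finite_measure set (borel_rV R m) -> \bar R},
    (forall n, mu (cube R m n) < +oo)%E /\
    forall g : borel_rV R m -> \bar R, measurable_fun setT g ->
      (forall v, 0 <= g v)%E -> (\int[mu]_v g v = integral_rV g)%E.
Proof.
elim: m => [|m [mu [mufin muE]]].
  have [|nu nuE] := @sigma_finite_measure_of_cubes R 0 \d_((0 : 'rV[R]_0) : borel_rV R 0).
    by move=> n; rewrite /= diracE ltry.
  exists nu; rewrite nuE; split=> [n|g mg g0]; first by rewrite /= diracE ltry.
  by rewrite integral_dirac// diracT mul1e.
pose ins (p : measurableTypeR R * borel_rV R m) : borel_rV R m.+1 := insert_coord ord0 p.1 p.2.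
have mins : measurable_fun setT ins by exact: measurable_insert_coord.
pose F : {mfun (measurableTypeR R * borel_rV R m)%type >-> borel_rV R m.+1} :=
  HB.pack ins (isMeasurableFun.Build _ _ _ _ _ mins).
have fin n : (pushforward (lebesgue_measure \x mu) F (cube R m.+1 n) < +oo)%E.
  rewrite /pushforward (_ : _ @^-1` _ = `[- n%:R, n%:R] `*` cube R m n); last first.
    apply/seteqP; split => -[a z] /=.
      by move=> /insert_coord_cube[an zn]; split => //; rewrite /= in_itv/= -ler_norml.
    by move=> [/=]; rewrite in_itv/= -ler_norml => ? ?; exact/insert_coord_cube.
  rewrite product_measure1E//; last exact: measurable_cube.
  by rewrite lte_mul_pinfty//= lebesgue_measure_itv/=; case: ifP.
have [nu nuE] := @sigma_finite_measure_of_cubes R m.+1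
  (pushforward (lebesgue_measure \x mu)%E F) fin.
exists nu; rewrite nuE; split => // g mg g0.
rewrite ge0_integral_pushforward//= preimage_setT.
rewrite fubini_tonelli1//=; last exact: measurableT_comp mg mins.
apply: eq_integral => t _; rewrite /fubini_F /=; rewrite muE//.
by apply: measurableT_comp mg _; exact: measurableT_comp mins (pair1_measurable t).
Qed.

Definition lebesgue_rV (R : realType) m : {sigma_finite_measure set (borel_rV R m) -> \bar R} :=
  sval (cid (lebesgue_rV_exists R m)).
Arguments lebesgue_rV : clear implicits.

Lemma integral_lebesgue_rV (R : realType) m (g : borel_rV R m -> \bar R) :
  measurable_fun setT g -> (forall v, 0 <= g v)%E ->
  (\int[lebesgue_rV R m]_v g v = integral_rV g)%E.
Proof. by have [_] := svalP (cid (lebesgue_rV_exists R m)); apply. Qed.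

Lemma lebesgue_rV_cube (R : realType) m n : (lebesgue_rV R m (cube R m n) < +oo)%E.
Proof. by have [h _] := svalP (cid (lebesgue_rV_exists R m)); apply: h. Qed.

(** * Change of variables *)

Section ge0_integral_comparison.
Local Open Scope ereal_scope.

(** The integral of a nonnegative function is a supremum over the simple functions below it, so a
    larger function admits more of them. Measurability does not enter this argument. *)
Lemma le_ge0_integral d (T : measurableType d) (R : realType)
    (mu : {measure set T -> \bar R}) (D : set T) (f g : T -> \bar R) :
  (forall x, D x -> 0 <= f x) -> (forall x, D x -> f x <= g x) ->
  \int[mu]_(x in D) f x <= \int[mu]_(x in D) g x.
Proof.
move=> f0 fg; rewrite integral_mkcond [leRHS]integral_mkcond.
have fp x : 0 <= (f \_ D) x by rewrite patchE; case: ifPn => // /set_mem /f0.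
have le x : (f \_ D) x <= (g \_ D) x.
  by rewrite !patchE; case: ifPn => // /set_mem /fg.
rewrite !ge0_integralTE//; last by move=> x; exact: le_trans (le x).
apply: le_ereal_sup => _ [h /= hf <-]; exists h => // x.
exact: le_trans (hf x) (le x).
Qed.

Import HBNNSimple.

Section approx.
Context d1 d (T1 : measurableType d1) (T : measurableType d) (R : realType).
Variables (mu : {measure set T1 -> \bar R}) (Y : T1 -> T) (a : T1 -> R).
Hypotheses (mY : measurable_fun setT Y) (ma : measurable_fun setT a).
Hypothesis a0 : forall z, (0 <= a z)%R.
Variables (h : T -> \bar R).
Hypotheses (mh : measurable_fun setT h) (h0 : forall y, 0 <= h y).

Let mhn n : measurable_fun setT
  (fun z => (nnsfun_approx measurableT mh n (Y z) * a z)%:E).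
Proof.
apply/measurable_EFinP; apply: measurable_funM => //.
by apply: measurableT_comp mY; exact: measurable_funPT.
Qed.

Let hn0 n z : 0 <= (nnsfun_approx measurableT mh n (Y z) * a z)%:E.
Proof. by rewrite lee_fin mulr_ge0. Qed.

Let nd z : {homo (fun n => (nnsfun_approx measurableT mh n (Y z) * a z)%:E) :
  n m / (n <= m)%N >-> n <= m}.
Proof.
by move=> n m nm; rewrite lee_fin ler_wpM2r//; exact/lefP/nd_nnsfun_approx.
Qed.

Lemma cvg_integral_nnsfun_approx :
  \int[mu]_z (nnsfun_approx measurableT mh n (Y z) * a z)%:E @[n --> \oo] -->
  \int[mu]_z (h (Y z) * (a z)%:E).
Proof.
have := @cvg_monotone_convergence _ _ _ mu _ measurableT
  (fun n z => (nnsfun_approx measurableT mh n (Y z) * a z)%:E) mhn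
  (fun n z _ => hn0 n z) (fun z _ => nd z).
rewrite [X in _ --> X -> _](_ : _ = \int[mu]_z (h (Y z) * (a z)%:E))//.
apply: eq_integral => z _; apply/cvg_lim => //.
under eq_fun do rewrite EFinM.
by apply: cvgeZr => //; exact: cvg_nnsfun_approx.
Qed.

Lemma integral_nnsfun_approx n :
  let g := nnsfun_approx measurableT mh n in
  \int[mu]_z (g (Y z) * a z)%:E =
  \sum_(r \in range g) r%:E * \int[mu]_z (\1_(g @^-1` [set r]) (Y z) * a z)%:E.
Proof.
move=> g.
have mi (r : R) : measurable_fun setT (fun z => (\1_(g @^-1` [set r]) (Y z) * a z)%:E).
  apply/measurable_EFinP; apply: measurable_funM => //.
  by apply: measurableT_comp mY; exact: measurable_indic.
transitivity (\int[mu]_z \sum_(r \in range g) (r%:E * (\1_(g @^-1` [set r]) (Y z) * a z)%:E)).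
  apply: eq_integral => z _; rewrite fimfunE EFinM -fsumEFin// ge0_mule_fsuml//.
    by apply: eq_fsbigr => r _; rewrite -!EFinM mulrA.
  by move=> r; rewrite EFinM nnfun_muleindic_ge0.
rewrite ge0_integral_fsum//; first last.
- move=> r z _; rewrite -EFinM lee_fin mulrA mulr_ge0//.
  by rewrite -lee_fin EFinM nnfun_muleindic_ge0.
- by move=> r; exact: measurable_funeM.
apply: eq_fsbigr => r /set_mem [t _ <-]; rewrite ge0_integralZl//.
  by move=> z _; rewrite lee_fin mulr_ge0.
by rewrite lee_fin.
Qed.

End approx.

(** An inequality between two weighted image measures, known on measurable sets, extends to
    nonnegative functions: decompose simple functions into level sets, then pass to the limit by
    monotone convergence. Stating the hypothesis with integrals of indicators avoids constructing
    the image measures. *)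
Lemma le_integral_indicP d1 d2 d (T1 : measurableType d1) (T2 : measurableType d2)
    (T : measurableType d) (R : realType)
    (mu1 : {measure set T1 -> \bar R}) (mu2 : {measure set T2 -> \bar R})
    (Y1 : T1 -> T) (Y2 : T2 -> T) (a1 : T1 -> R) (a2 : T2 -> R) :
  measurable_fun setT Y1 -> measurable_fun setT Y2 ->
  measurable_fun setT a1 -> measurable_fun setT a2 ->
  (forall z, (0 <= a1 z)%R) -> (forall z, (0 <= a2 z)%R) ->
  (forall B, measurable B -> \int[mu1]_z (\1_B (Y1 z) * a1 z)%:E <=
                             \int[mu2]_z (\1_B (Y2 z) * a2 z)%:E) ->
  forall h : T -> \bar R, measurable_fun setT h -> (forall y, 0 <= h y) ->
  \int[mu1]_z (h (Y1 z) * (a1 z)%:E) <= \int[mu2]_z (h (Y2 z) * (a2 z)%:E).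
Proof.
move=> mY1 mY2 ma1 ma2 a10 a20 le12 h mh h0.
have c1 := @cvg_integral_nnsfun_approx _ _ _ _ _ mu1 _ _ mY1 ma1 a10 _ mh h0.
have c2 := @cvg_integral_nnsfun_approx _ _ _ _ _ mu2 _ _ mY2 ma2 a20 _ mh h0.
rewrite -(cvg_lim _ c1)// -(cvg_lim _ c2)//; apply: lee_lim.
- by apply/cvg_ex; eexists; exact: c1.
- by apply/cvg_ex; eexists; exact: c2.
- apply: nearW => n; rewrite !integral_nnsfun_approx//.
  apply: lee_fsum => // r [t _ <-]; apply: lee_wpmul2l; first by rewrite lee_fin.
  exact: le12.
Qed.

End ge0_integral_comparison.

(** * The one-dimensional area inequality *)

Section area_inequality.
Local Open Scope ereal_scope.
Context {R : realType}.
Notation mu := (@lebesgue_measure R).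
Variables (q q' : R -> R).
Hypotheses (mq : measurable_fun setT q) (mq' : measurable_fun setT q').

Lemma derive_itv_integral (s : R) (a b : R) : (a <= b)%R ->
  (forall t, (a <= t <= b)%R -> is_derive t 1%R q (q' t)) ->
  (forall t, (a <= t <= b)%R -> {for t, continuous q'}) ->
  \int[mu]_(t in `[a, b]) (s * q' t)%:E = (s * (q b - q a))%:E.
Proof.
rewrite le_eqVlt => /predU1P[<- _ _|ab dq cq'].
  by rewrite set_itv1 integral_set1 subrr mulr0.
have cq t : (a <= t <= b)%R -> {for t, continuous q}.
  by move=> /dq h; apply/differentiable_continuous/derivable1_diffP.
have dsq t : (a <= t <= b)%R -> is_derive t 1%R (s \*: q)%R (s * q' t)%R.
  by move=> /dq h; exact: is_deriveZ.
rewrite (@continuous_FTC2 _ _ (s \*: q)%R _ _ ab).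
- by rewrite -EFinB mulrBr.
- apply: continuous_in_subspaceT => t; rewrite inE/= in_itv/= => /cq' h.
  by apply: continuousM => //; exact: cst_continuous.
- split=> [t||].
  + by rewrite in_itv/= => /andP[/ltW at_ /ltW tb]; case: (dsq t); rewrite ?at_ ?tb.
  + apply: cvg_at_right_filter; apply: continuousM; first exact: cst_continuous.
    by apply: cq; rewrite lexx ltW.
  + apply: cvg_at_left_filter; apply: continuousM; first exact: cst_continuous.
    by apply: cq; rewrite lexx ltW.
- move=> t; rewrite in_itv/= => /andP[/ltW at_ /ltW tb].
  by rewrite derive1E; apply: derive_val; apply: dsq; rewrite at_ tb.
Qed.

(** The part of [[a, b]] that [q] sends into [[c, d]] is compact. Let a' and b' be its least and
    greatest points: since s q' >= 0, integrating over all of [a', b'] only adds mass, and the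
    result s (q b' - q a') is at most d - c because q a' and q b' lie in [[c, d]]. *)
Lemma derive_itv_integral_preimage (s : R) (a b c d : R) : (a <= b)%R -> (c <= d)%R ->
  (`|s| = 1)%R ->
  (forall t, (a <= t <= b)%R -> is_derive t 1%R q (q' t)) ->
  (forall t, (a <= t <= b)%R -> {for t, continuous q'}) ->
  (forall t, (a <= t <= b)%R -> 0 <= s * q' t)%R ->
  \int[mu]_(t in `[a, b] `&` q @^-1` `[c, d]) (s * q' t)%:E <= (d - c)%:E.
Proof.
move=> ab cd s1 dq cq' sq'.
set K := _ `&` _.
have cq t : (a <= t <= b)%R -> {for t, continuous q}.
  by move=> /dq h; apply/differentiable_continuous/derivable1_diffP.
have [K0|/set0P K0] := eqVneq K set0; first by rewrite K0 integral_set0 lee_fin subr_ge0.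
have cK : compact K.
  apply: (subclosed_compact _ (@segment_compact _ a b)); last by move=> t [].
  move=> t Kt; have tab : `[a, b]%classic t.
    by apply: itv_closed; apply: closure_subset Kt => ? [].
  have cl : closed (`[c, d]%classic : set R) by exact: itv_closed.
  split => //; apply: cl => A /(cq t tab) /Kt [u [[_ Ku] Au]].
  by exists (q u).
have [a' /set_mem Ka' a'K] : exists2 x, x \in K & forall y, y \in K -> (x <= y)%R.
  by apply: (@compact_EVT_min _ _ id) => //; apply: continuous_subspaceT => ?; exact: cvg_id.
have [b' /set_mem Kb' b'K] : exists2 x, x \in K & forall y, y \in K -> (y <= x)%R.
  by apply: (@compact_EVT_max _ _ id) => //; apply: continuous_subspaceT => ?; exact: cvg_id.
have a'b' : (a' <= b')%R by apply: a'K; exact/mem_set.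
have sub t : (a' <= t <= b')%R -> (a <= t <= b)%R.
  move=> /andP[a't tb']; move: Ka' Kb' => [/=] + _ [/=] + _.
  rewrite !in_itv/= => /andP[aa' _] /andP[_ b'b].
  by rewrite (le_trans aa' a't) (le_trans tb').
apply: (@le_trans _ _ (\int[mu]_(t in `[a', b']) (s * q' t)%:E)).
  rewrite integral_mkcond [leRHS]integral_mkcond; apply: le_ge0_integral => t _.
    rewrite patchE; case: ifPn => // /set_mem [+ _].
    by rewrite /= in_itv/= lee_fin => /sq'.
  rewrite !patchE; case: ifPn => [tK|_].
    by rewrite ifT// inE/= in_itv/= a'K ?b'K.
  by case: ifPn => // /set_mem; rewrite /= in_itv/= lee_fin => /sub/sq'.
rewrite (derive_itv_integral s a'b' (fun t h => dq t (sub t h)) (fun t h => cq' t (sub t h))).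
rewrite lee_fin (le_trans (ler_norm _))// normrM s1 mul1r.
move: Ka' Kb' => [_ /=] + [_ /=]; rewrite !in_itv/= => /andP[? ?] /andP[? ?].
by rewrite ler_norml; apply/andP; split; lra.
Qed.

(** The Lebesgue measure of [B] is an infimum over countable covers by half-open intervals, so it
    suffices to sum [derive_itv_integral_preimage] over the intervals of one cover. *)
Lemma integral_preimage_itv_le_lebesgue (s a b : R) (B : set R) : (a <= b)%R ->
  (`|s| = 1)%R ->
  (forall t, (a <= t <= b)%R -> is_derive t 1%R q (q' t)) ->
  (forall t, (a <= t <= b)%R -> {for t, continuous q'}) ->
  (forall t, (a <= t <= b)%R -> 0 <= s * q' t)%R ->
  \int[mu]_(t in `[a, b]) (\1_B (q t) * (s * q' t))%:E <= mu B.
Proof.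
move=> ab s1 dq cq' sq'.
have pos (X : set R) t : (a <= t <= b)%R -> 0 <= (\1_X (q t) * (s * q' t))%:E.
  by move=> /sq' h; rewrite lee_fin mulr_ge0.
apply: le_ereal_inf_tmp => _ [A [mA BA] <-].
apply: (@le_trans _ _
  (\int[mu]_(t in `[a, b]) \sum_(0 <= k <oo) (\1_(A k) (q t) * (s * q' t))%:E)).
  apply: le_ge0_integral => t; rewrite /= in_itv/= => tab; first exact: pos.
  have [Bt|nBt] := pselect (B (q t)); last first.
    rewrite indicE memNset// mul0r; apply: nneseries_ge0 => k _ _; exact: pos.
  have [k _ Ak] := BA _ Bt.
  apply: le_trans (nneseries_lim_ge k.+1 _); last by move=> i _ _; exact: pos.
  rewrite big_nat_recr//= !indicE mem_set// (mem_set Ak) leeDr//.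
  by apply: sume_ge0 => i _; exact: pos.
rewrite integral_nneseries//; last first.
- by move=> k t; rewrite /= in_itv/=; exact: pos.
- move=> k; apply: measurable_funTS; apply/measurable_EFinP.
  apply: measurable_funM; last exact: measurable_funM.
  apply: measurableT_comp mq; apply: measurable_indic.
  by have [[c d] _ <-] := mA k; exact: measurable_itv.
apply: lee_nneseries => [k _ _|k _].
  by apply: integral_ge0 => t; rewrite /= in_itv/=; exact: pos.
have [[c d] _ <-] := mA k; rewrite /=.
have [dc|cd] := leP d c.
  rewrite wlength_itv/= lte_fin ltNge dc/= integral0_eq// => t _.
  rewrite indicE memNset ?mul0r//= in_itv/= => /andP[cq qd].
  by have := lt_le_trans cq (le_trans qd dc); rewrite ltxx.
rewrite (wlength_itv_bnd _ _ _ (ltW cd)).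
apply: le_trans (derive_itv_integral_preimage ab (ltW cd) s1 dq cq' sq').
rewrite integral_mkcondr; apply: le_ge0_integral => t; rewrite /= in_itv/= => tab.
  exact: pos.
rewrite patchE indicE; have [h|h] := boolP (q t \in `]c, d]%classic).
  rewrite mul1r ifT// inE/=; move: h; rewrite inE/= !in_itv/=.
  by move=> /andP[/ltW -> ->].
by rewrite mul0r; case: ifPn => // _; rewrite lee_fin sq'.
Qed.

(** The case of indicators is [integral_preimage_itv_le_lebesgue]; [le_integral_indicP] extends it,
    with weight s q' on [[a, b]] on one side and weight 1 on the other. *)
Lemma area_inequality_itv (s a b : R) (h : R -> \bar R) : (a <= b)%R ->
  (`|s| = 1)%R ->
  (forall t, (a <= t <= b)%R -> is_derive t 1%R q (q' t)) ->
  (forall t, (a <= t <= b)%R -> {for t, continuous q'}) ->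
  (forall t, (a <= t <= b)%R -> 0 <= s * q' t)%R ->
  measurable_fun setT h -> (forall t, 0 <= h t) ->
  \int[mu]_(t in `[a, b]) (h (q t) * (s * q' t)%:E) <= \int[mu]_t h t.
Proof.
move=> ab s1 dq cq' sq' mh h0.
pose a1 t : R := (\1_(`[a, b]%classic : set R) t * (s * q' t))%R.
have a1E (g : R -> R) t : (g t * a1 t)%:E =
    ((fun t => (g t * (s * q' t))%:E) \_ (`[a, b] : set R)) t.
  by rewrite patchE /a1 indicE; case: ifPn => _; rewrite ?mul1r ?mul0r ?mulr0.
have ma1 : measurable_fun setT a1.
  by apply: measurable_funM; [exact: measurable_indic|exact: measurable_funM].
have a10 t : (0 <= a1 t)%R.
  rewrite /a1 indicE; case: (boolP (_ \in _)); last by rewrite mul0r.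
  by rewrite inE/= in_itv/= mul1r => /sq'.
have -> : \int[mu]_(t in `[a, b]) (h (q t) * (s * q' t)%:E) =
    \int[mu]_t (h (q t) * (a1 t)%:E).
  rewrite integral_mkcond; apply: eq_integral => t _.
  rewrite patchE /a1 indicE; case: ifPn => _; rewrite ?mul1r//.
  by rewrite mul0r mule0.
apply: (@le_trans _ _ (\int[mu]_t (h t * (cst 1%R t)%:E))); last first.
  by apply: le_ge0_integral => t _; rewrite mule1.
apply: (@le_integral_indicP _ _ _ _ _ _ R mu mu q id a1 (cst 1%R)) => //.
move=> B mB; apply: (@le_trans _ _ (mu B)); last first.
  under eq_integral do rewrite mulr1.
  by rewrite integral_indic// setIT.
apply: le_trans (integral_preimage_itv_le_lebesgue B ab s1 dq cq' sq').
rewrite [leRHS]integral_mkcond; apply: le_ge0_integral => t _.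
  by rewrite lee_fin mulr_ge0.
by have := a1E (fun t => \1_B (q t)) t => /= <-.
Qed.

(** Rational intervals inside [O] on which [q] is monotone. There are countably many of them, and by
    continuity of [q'] they cover every point of [O] where [q'] does not vanish. *)
Let good (O : set R) (p : rat * rat) := (ratr p.1 <= ratr p.2 :> R)%R /\
  exists2 s : R, (`|s| = 1)%R &
    forall t, (ratr p.1 <= t <= ratr p.2)%R -> O t /\ (0 <= s * q' t)%R.

Let exists_good (O : set R) t : open O -> O t -> {for t, continuous q'} ->
  q' t != 0%R -> exists2 p, good O p & (ratr p.1 <= t <= ratr p.2)%R.
Proof.
move=> oO Ot cq' q't; pose s := Num.sg (q' t).
have s1 : (`|s| = 1)%R by rewrite normr_sg q't.
have st : (0 < s * q' t)%R by rewrite /s -normrEsg normr_gt0.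
have : nbhs t (O `&` [set u | (0 < s * q' u)%R]).
  apply: filterI; first exact: open_nbhs_nbhs.
  have : {for t, continuous (fun u => s * q' u)%R}.
    by apply: continuousM => //; exact: cst_continuous.
  by move=> /(_ _ (lt_nbhsr st))/=.
move=> /nbhs_ballP[e /= e0 eO].
have /rat_in_itvoo[a] : (t - e < t)%R by rewrite ltrBlDr ltrDl.
have /rat_in_itvoo[b] : (t < t + e)%R by rewrite ltrDl.
rewrite !in_itv/= => /andP[tb be] /andP[ea at_].
exists (a, b); last by rewrite /= !ltW.
split; first by rewrite /= ltW// (lt_trans at_).
exists s => // u /= /andP[au ub].
have [|? /ltW//] := eO u.
by rewrite /ball/= ltr_distlC (lt_le_trans ea)// (le_lt_trans ub).
Qed.

(* J is a measurable left inverse of q on E; it turns the pieces of E on which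
   q is monotone into disjoint measurable sets of values. *)
Lemma area_inequality (J : R -> R) (O E : set R) (h : R -> \bar R) :
  measurable_fun setT J -> open O -> measurable E -> E `<=` O ->
  (forall t, O t -> is_derive t 1%R q (q' t)) ->
  (forall t, O t -> {for t, continuous q'}) ->
  (forall t, E t -> J (q t) = t) ->
  measurable_fun setT h -> (forall t, 0 <= h t) ->
  \int[mu]_(t in E) (h (q t) * `|q' t|%:E) <= \int[mu]_t h t.
Proof.
move=> mJ oO mE EO dq cq' Jq mh h0.
pose G n : set R := if unpickle n is Some p then
  (if `[< good O p >] then `[ratr p.1, ratr p.2]%classic else set0) else set0.
have mG n : measurable (G n) by rewrite /G; case: unpickle => // p; case: asboolP.
(* The good intervals overlap; this makes their traces on [E] disjoint without losing any point. *)
pose F := seqDU (fun n => E `&` G n).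
have mF n : measurable (F n).
  apply: measurableD; first exact: measurableI.
  by apply: bigsetU_measurable => i _; exact: measurableI.
have FE n : F n `<=` E `&` G n by exact: subset_seqDU.
have mf : measurable_fun setT (fun t => h (q t) * `|q' t|%:E).
  apply: emeasurable_funM; first exact: measurableT_comp.
  by apply/measurable_EFinP; exact: measurableT_comp.
have f0 t : 0 <= h (q t) * `|q' t|%:E by rewrite mule_ge0.
apply: (@le_trans _ _ (\int[mu]_(t in \bigcup_n F n) (h (q t) * `|q' t|%:E))).
  rewrite integral_mkcond [leRHS]integral_mkcond; apply: le_ge0_integral => t _.
    by rewrite patchE; case: ifP.
  rewrite patchE; case: ifPn => [/set_mem Et|_]; last by rewrite patchE; case: ifP.
  (* Critical points of [q] may lie in no good interval, but the integrand vanishes there. *)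
  have [q't0|q't0] := eqVneq (q' t) 0%R.
    by rewrite q't0 normr0 mule0 patchE; case: ifP => // _; rewrite q't0 normr0 mule0.
  rewrite patchE ifT// inE -seqDU_bigcup_eq.
  have [p Pp tp] := exists_good oO (EO _ Et) (cq' _ (EO _ Et)) q't0.
  by exists (pickle p); [exact: I|split; [exact: Et|rewrite /G pickleK asboolT]].
rewrite ge0_integral_bigcup//; last 2 first.
- exact: measurable_funTS.
- exact: trivIset_seqDU.
(* On [F n] one has J (q t) = t, so q maps [F n] into the preimage of [F n] under [J]. These
   preimages are disjoint, hence the localized integrals of [h] sum to at most the full one. *)
- apply: (@le_trans _ _ (\sum_(0 <= n <oo) \int[mu]_(y in J @^-1` F n) h y)).
    apply: lee_nneseries => [n _ _|n _]; first exact: integral_ge0.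
    have [/set0P[u Fu]|/negPn/eqP ->] := boolP (F n != set0); last first.
      by rewrite integral_set0; exact: integral_ge0.
    have [p Pp Gp] : exists2 p, good O p & G n = `[ratr p.1, ratr p.2]%classic.
      have [_] := FE _ _ Fu; rewrite /G; case: unpickle => // p.
      by case: asboolP => // Pp _; exists p.
    case: Pp => ab [s s1 sP].
    have mhJ : measurable_fun setT (h \_ (J @^-1` F n)).
      have mJF : measurable (J @^-1` F n).
        by rewrite -[X in measurable X]setTI; exact: mJ.
      by apply/(measurable_restrictT _ mJF); exact: measurable_funTS.
    rewrite [leRHS]integral_mkcond.
    have hJ0 y : 0 <= (h \_ (J @^-1` F n)) y by rewrite patchE; case: ifP.
    apply: le_trans (area_inequality_itv ab s1 (fun t tab => dq t (sP t tab).1)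
       (fun t tab => cq' t (sP t tab).1) (fun t tab => (sP t tab).2) mhJ hJ0).
    rewrite integral_mkcond [leRHS]integral_mkcond; apply: le_ge0_integral => t _.
      by rewrite patchE; case: ifP.
    rewrite patchE; case: ifPn => [/set_mem Ft|_]; last first.
      rewrite patchE; case: ifPn => // /set_mem/=; rewrite in_itv/= => /sP[_ sq'].
      by rewrite mule_ge0.
    have [Et Gt] := FE _ _ Ft; rewrite patchE ifT; last by rewrite inE -Gp.
    rewrite patchE ifT; last by rewrite inE/= Jq.
    move: Gt; rewrite Gp/= in_itv/= => /sP[_ sq'].
    by rewrite -(ger0_norm sq') normrM s1 mul1r.
  rewrite -ge0_integral_bigcup//.
  + by rewrite [leLHS]integral_mkcond; apply: le_ge0_integral => t _;
      rewrite patchE; case: ifP.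
  + by move=> n; rewrite -[X in measurable X]setTI; exact: mJ.
  + exact: measurable_funTS.
  + apply/trivIsetP => i j _ _ ij; rewrite -preimage_setI.
    by move/trivIsetP : (trivIset_seqDU (fun n => E `&` G n)) => ->//; rewrite preimage_set0.
Qed.

End area_inequality.

Section affine_change.
Local Open Scope ereal_scope.
Context {R : realType}.
Notation mu := (@lebesgue_measure R).

Lemma integral_affine_le (a c : R) (h : R -> \bar R) : a != 0%R ->
  measurable_fun setT h -> (forall t, 0 <= h t) ->
  `|a|%:E * \int[mu]_t h (a * t + c)%R <= \int[mu]_t h t.
Proof.
move=> a0 mh h0.
have mq : measurable_fun setT (fun t : R => a * t + c)%R.
  by apply: measurable_funD => //; exact: measurable_funM.
rewrite -ge0_integralZl//; last exact: measurableT_comp mh mq.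
under eq_integral do rewrite muleC.
apply: (@area_inequality R _ (cst a) mq _ (fun t => (t - c) / a)%R setT setT) => //.
- by apply: measurable_funM => //; exact: measurable_funB.
- exact: openT.
- move=> t _; have da : is_derive t 1%R (a \*: id + cst c)%R (a *: 1 + 0)%R by exact: is_deriveD.
  by move: da; rewrite addr0 /GRing.scale/= mulr1.
- by move=> t _; exact: cst_continuous.
- by move=> t _; rewrite addrK mulrC mulKf.
Qed.

(** The reverse inequality is [integral_affine_le] for the inverse affine map, applied to [h]
    composed with the map itself. *)
Lemma integral_affine (a c : R) (h : R -> \bar R) : a != 0%R ->
  measurable_fun setT h -> (forall t, 0 <= h t) ->
  `|a|%:E * \int[mu]_t h (a * t + c)%R = \int[mu]_t h t.
Proof.
move=> a0 mh h0; apply/eqP; rewrite eq_le integral_affine_le//=.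
have mq : measurable_fun setT (fun t : R => a * t + c)%R.
  by apply: measurable_funD => //; exact: measurable_funM.
have := @integral_affine_le a^-1 (- (c / a)) (fun t => h (a * t + c)%R).
rewrite invr_eq0 => /(_ a0 (measurableT_comp mh mq) (fun t => h0 _)).
under eq_integral do rewrite mulrDr mulVKf// mulrN mulrCA mulfV// mulr1 subrK.
move=> /(lee_wpmul2l (_ : 0 <= `|a|%:E)) => /(_ _)/=.
by rewrite muleA -EFinM normfV mulfV ?normr_eq0// mul1e; apply; rewrite lee_fin.
Qed.

End affine_change.

(** * Tonelli's theorem and affine substitutions in R^m *)

Section tonelli_rV.
Local Open Scope ereal_scope.
Context {R : realType}.

(** Interchanges the insertion of coordinate 0 with that of a later one; this is the index
    bookkeeping behind [integral_rV_insert]. *)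
Lemma insert_coord_lift m (j : 'I_m.+1) (t a : R) (z : 'rV[R]_m) :
  insert_coord (lift ord0 j) t (insert_coord ord0 a z : 'rV_(m.+2.-1)) =
  insert_coord ord0 a (insert_coord j t z : 'rV_(m.+2.-1)).
Proof.
apply/rowP => k; rewrite !mxE; case: (unliftP ord0 k) => [k'|] ->.
  rewrite mxE; case: (unliftP j k') => [l|] ->.
    rewrite (_ : lift ord0 (lift j l : 'I_m.+2.-1) =
      lift (lift ord0 (j : 'I_m.+2.-1)) (lift (ord0 : 'I_m.+1) l : 'I_m.+2.-1)).
      by rewrite liftK mxE liftK.
    by apply/val_inj; rewrite /= /bump /= !add1n ltnS; case: (j <= l)%N.
  by rewrite unlift_none.
rewrite {1 2}(_ : ord0 = lift (lift ord0 (j : 'I_m.+2.-1)) (ord0 : 'I_m.+2.-1)) ?liftK ?mxE ?unlift_none//.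
exact/val_inj.
Qed.

Lemma measurable_integral_rV d (T : measurableType d) m (g : T * borel_rV R m -> \bar R) :
  measurable_fun setT g -> (forall p, 0 <= g p) ->
  measurable_fun setT (fun t => \int[lebesgue_rV R m]_z g (t, z)).
Proof. by move=> mg g0; exact: measurable_fun_fubini_tonelli_F. Qed.

(** [integral_rV] always splits off coordinate 0, whereas a chart may be a graph over any coordinate
    hyperplane. Induction on the dimension and one exchange by Tonelli bring coordinate [i] to the
    outside. *)
Lemma integral_rV_insert m (i : 'I_m.+1) (g : borel_rV R m.+1 -> \bar R) :
  measurable_fun setT g -> (forall v, 0 <= g v) ->
  \int[lebesgue_rV R m.+1]_v g v =
  \int[lebesgue_measure]_t \int[lebesgue_rV R m]_z g (insert_coord i t z).
Proof.
have i0 k (f : borel_rV R k.+1 -> \bar R) : measurable_fun setT f -> (forall v, 0 <= f v) ->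
    \int[lebesgue_rV R k.+1]_v f v =
    \int[lebesgue_measure]_t \int[lebesgue_rV R k]_z f (insert_coord ord0 t z).
  move=> mf f0; rewrite integral_lebesgue_rV//; apply: eq_integral => t _.
  rewrite integral_lebesgue_rV//; apply: measurableT_comp mf _.
  exact: measurable_insert_coord.
elim: m i g => [|m ih] i g mg g0; first by rewrite (ord1 i) i0.
case: (unliftP ord0 i) => [j|] ->; last exact: i0.
rewrite (i0 _ g mg g0).
transitivity (\int[lebesgue_measure]_a \int[lebesgue_measure]_t
    \int[lebesgue_rV R m]_z g (insert_coord ord0 a (insert_coord j t z : 'rV_(m.+2.-1)))).
  apply: eq_integral => a _; apply: (ih _ (fun v => g (insert_coord ord0 a v))) => //.
  by apply: measurableT_comp mg _; exact: measurable_insert_coord.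
rewrite (@fubini_tonelli _ _ _ _ R lebesgue_measure lebesgue_measure (fun p =>
  \int[lebesgue_rV R m]_z g (insert_coord ord0 p.1 (insert_coord j p.2 z : 'rV_(m.+2.-1)))))/=; last 2 first.
- apply: (@measurable_integral_rV _ _ _ (fun q =>
    g (insert_coord ord0 q.1.1 (insert_coord j q.1.2 q.2 : 'rV_(m.+2.-1))))) => //.
  apply: measurableT_comp mg _; apply: measurable_insert_coord.
    exact: measurableT_comp.
  by apply: measurable_insert_coord => //; exact: measurableT_comp.
- by move=> p; exact: integral_ge0.
apply: eq_integral => t _.
rewrite (i0 _ (fun w => g (insert_coord (lift ord0 j) t w)) _ (fun w => g0 _)); last first.
  by apply: measurableT_comp mg _; exact: measurable_insert_coord.
by under eq_integral do under eq_integral do rewrite -insert_coord_lift.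
Qed.

Lemma integral_rV_insert_swap m (i : 'I_m.+1) (g : borel_rV R m.+1 -> \bar R) :
  measurable_fun setT g -> (forall v, 0 <= g v) ->
  \int[lebesgue_rV R m.+1]_v g v =
  \int[lebesgue_rV R m]_z \int[lebesgue_measure]_t g (insert_coord i t z).
Proof.
move=> mg g0; rewrite (integral_rV_insert i)//.
rewrite (@fubini_tonelli _ _ _ _ R lebesgue_measure (lebesgue_rV R m)
  (fun p => g (insert_coord i p.1 p.2)))//.
by apply: measurableT_comp mg _; exact: measurable_insert_coord.
Qed.

Lemma measurable_affine_rV m (a : R) (c : 'rV[R]_m) :
  measurable_fun setT (fun v : borel_rV R m => (a *: (v : 'rV[R]_m) + c)%R : borel_rV R m).
Proof.
apply: measurable_fun_rV => k; under eq_fun do rewrite !mxE.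
by apply: measurable_funD => //; apply: measurable_funM => //; exact: measurable_coord.
Qed.

(** One coordinate at a time, each contributing a factor |a| through [integral_affine]. *)
Lemma integral_rV_affine m (a : R) (c : 'rV[R]_m) (g : borel_rV R m -> \bar R) :
  a != 0%R -> measurable_fun setT g -> (forall v, 0 <= g v) ->
  (`|a| ^+ m)%:E * \int[lebesgue_rV R m]_v g (a *: (v : 'rV[R]_m) + c)%R =
  \int[lebesgue_rV R m]_v g v.
Proof.
move=> a0; elim: m c g => [|m ih] c g mg g0.
  rewrite expr0 mul1e; apply: eq_integral => v _.
  by congr (g _); apply/rowP => -[].
have mga := measurableT_comp mg (measurable_affine_rV a c).
have /= -> := integral_rV_insert ord0 mga (fun v => g0 _).
rewrite (integral_rV_insert ord0 mg g0).
rewrite -[RHS](integral_affine (c ord0 ord0) a0); last 2 first.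
- apply: (@measurable_integral_rV _ _ _ (fun q => g (insert_coord ord0 q.1 q.2))) => //.
  by apply: measurableT_comp mg _; exact: measurable_insert_coord.
- by move=> t; exact: integral_ge0.
rewrite exprS EFinM -muleA; congr (_ * _).
rewrite -ge0_integralZl//=; last 2 first.
- apply: (@measurable_integral_rV _ (measurableTypeR R) _ (fun q =>
    g (a *: (insert_coord ord0 q.1 q.2 : 'rV[R]_m.+1) + c)%R)) => //.
  apply: (measurableT_comp mga (_ : measurable_fun setT (fun q : measurableTypeR R * borel_rV R m =>
    insert_coord ord0 q.1 q.2 : borel_rV R m.+1))).
  exact: measurable_insert_coord.
- by move=> t _; exact: integral_ge0.
apply: eq_integral => t _.
rewrite -(ih (col' ord0 c) (fun z => g (insert_coord ord0 (a * t + c ord0 ord0)%R z)))//; last first.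
  by apply: measurableT_comp mg _; exact: measurable_insert_coord.
congr (_ * _); apply: eq_integral => z _; congr (g _).
apply/rowP => k; rewrite !mxE; case: (unliftP ord0 k) => [k'|] -> //.
by rewrite !mxE.
Qed.

End tonelli_rV.

(** * Geometry of convex domains with C^1 boundary *)

Section dot.
Context {R : realType} {m : nat}.
Implicit Types u v w : 'rV[R]_m.

Lemma dotC u v : dot u v = dot v u.
Proof. by apply: eq_bigr => k _; rewrite mulrC. Qed.

Lemma dotDl u v w : dot (u + v) w = dot u w + dot v w.
Proof. by rewrite -big_split; apply: eq_bigr => k _; rewrite mxE mulrDl. Qed.

Lemma dotZl a u v : dot (a *: u) v = a * dot u v.
Proof. by rewrite mulr_sumr; apply: eq_bigr => k _; rewrite mxE mulrA. Qed.

Lemma dotNl u v : dot (- u) v = - dot u v.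
Proof. by rewrite -scaleN1r dotZl mulN1r. Qed.

Lemma dotZr a u v : dot u (a *: v) = a * dot u v.
Proof. by rewrite dotC dotZl dotC. Qed.

Lemma dot_ge0 u : 0 <= dot u u.
Proof. by apply: sumr_ge0 => k _; rewrite -expr2 sqr_ge0. Qed.

End dot.

Lemma dot_insert_coord (R : realType) m (i : 'I_m.+1) (w : 'rV[R]_m.+1) a (z : 'rV[R]_m) :
  dot w (insert_coord i a z) = w 0 i * a + dot (col' i w) z.
Proof.
rewrite /dot (bigD1_ord i)//= mxE unlift_none; congr (_ + _).
by apply: eq_bigr => j _; rewrite !mxE liftK.
Qed.

Lemma col'_insert_coord (R : realType) m (i : 'I_m.+1) a (z : 'rV[R]_m) :
  col' i (insert_coord i a z) = z.
Proof. by apply/rowP => j; rewrite !mxE liftK. Qed.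

Lemma insert_coordE (R : realType) m (i : 'I_m.+1) a (z : 'rV[R]_m) :
  insert_coord i a z 0 i = a.
Proof. by rewrite mxE unlift_none. Qed.

Section rV_limits.
Context {R : realType} {T : Type} {F : set_system T} {FF : Filter F}.

Lemma cvg_rV m (f : T -> 'rV[R]_m) (l : 'rV[R]_m) :
  (forall k, f t 0 k @[t --> F] --> l 0 k) -> f @ F --> l.
Proof.
move=> fl; apply/cvg_ballP => e e0.
have : \forall t \near F, forall k, `|l 0 k - f t 0 k| < e.
  by apply: filter_forall => k; move/cvgrPdist_lt : (fl k) => /(_ e e0).
by apply: filterS => t ht; exact/rV_ball_coordP.
Qed.

Lemma cvg_coord m (f : T -> 'rV[R]_m) (l : 'rV[R]_m) k :
  f @ F --> l -> f t 0 k @[t --> F] --> l 0 k.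
Proof.
move=> fl; have h := @coord_continuous R 1 m 0 k l.
exact: (cvg_comp _ _ fl h).
Qed.

Lemma cvg_bigsum (I : Type) (r : seq I) (f : I -> T -> R) (l : I -> R) :
  (forall i, f i @ F --> l i) ->
  \sum_(i <- r) f i t @[t --> F] --> \sum_(i <- r) l i.
Proof.
move=> fl; elim: r => [|i r ih].
  by rewrite big_nil; under eq_fun do rewrite big_nil; exact: cvg_cst.
by rewrite big_cons; under eq_fun do rewrite big_cons; exact: cvgD.
Qed.

Lemma cvg_dot m (f g : T -> 'rV[R]_m) (a b : 'rV[R]_m) :
  f @ F --> a -> g @ F --> b -> dot (f t) (g t) @[t --> F] --> dot a b.
Proof. by move=> fa gb; apply: cvg_bigsum => k; apply: cvgM; exact: cvg_coord. Qed.

Lemma cvg_col' m (i : 'I_m.+1) (f : T -> 'rV[R]_m.+1) (l : 'rV[R]_m.+1) :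
  f @ F --> l -> col' i (f t) @[t --> F] --> col' i l.
Proof.
move=> fl; apply: cvg_rV => k; rewrite mxE.
by under eq_fun do rewrite mxE; exact: cvg_coord.
Qed.

End rV_limits.

Section derive_line.
Context {R : realType} {m : nat}.

Lemma grad_dot (phi : 'rV[R]_m -> R) z w : differentiable phi z ->
  'D_w phi z = dot (grad phi z) w.
Proof.
move=> dphi; rewrite deriveE// {1}(row_sum_delta w) linear_sum; apply: eq_bigr => j _.
by rewrite linearZ /= mxE deriveE// mulrC.
Qed.

Lemma is_derive_line (phi : 'rV[R]_m -> R) c w (r : R) :
  differentiable phi (c + r *: w) ->
  is_derive r 1 (fun r => phi (c + r *: w)) (dot (grad phi (c + r *: w)) w).
Proof.
move=> dphi; have dw : derivable phi (c + r *: w) w by exact: diff_derivable.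
have E : (fun h : R => h^-1 *: (((fun r => phi (c + r *: w)) \o shift r) (h *: 1) -
    phi (c + r *: w))) =
    (fun h : R => h^-1 *: ((phi \o shift (c + r *: w)) (h *: w) - phi (c + r *: w))).
  apply/funext => h /=; congr (_ *: (phi _ - _)).
  by rewrite scalerDl /GRing.scale/= mulr1 addrCA.
split; first by rewrite /derivable E.
by rewrite /derive E -grad_dot.
Qed.

Lemma is_derive_line_comp (phi : 'rV[R]_m -> R) c w (al : R -> R) (al' t : R) :
  differentiable phi (c + al t *: w) -> is_derive t 1 al al' ->
  is_derive t 1 (fun t => phi (c + al t *: w))
    (dot (grad phi (c + al t *: w)) w * al').
Proof. by move=> dphi dal; apply: is_derive1_comp (is_derive_line dphi) dal. Qed.

End derive_line.

(** First-order test used to decide on which side of the boundary a short segment leaving a boundary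
    point lies. *)
Lemma derive_gt0_right (R : realType) (f : R -> R) l :
  is_derive (0 : R) (1 : R) f l -> f 0 = 0 -> 0 < l -> \forall e \near 0^'+, 0 < f e.
Proof.
move=> [df fl] f0 l0.
have : h^-1 *: ((f \o shift 0) (h *: 1) - f 0) @[h --> (0:R)^'] --> l.
  by rewrite -fl; exact: df.
move=> /cvgr_gt /(_ 0 l0) fpos.
have fpos' : \forall h \near (0:R)^'+, 0 < h^-1 *: ((f \o shift 0) (h *: 1) - f 0).
  move: fpos; rewrite !near_withinE; apply: filterS => h + h0; apply.
  by rewrite gt_eqF.
near=> h; have h0 : 0 < h by near: h; exact: nbhs_right_gt.
have : 0 < h^-1 *: ((f \o shift 0) (h *: 1) - f 0) by near: h.
by rewrite f0 subr0 /= addr0 /GRing.scale/= mulr1 pmulr_rgt0// invr_gt0.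
Unshelve. all: by end_near. Qed.

Section convex_open.
Context {R : realType} {d : nat} (D : set 'rV[R]_d).
Hypotheses (Dopen : open D) (Dconv : convex_set D).

Lemma convex_setP x y (t : R) : 0 <= t <= 1 -> D x -> D y -> D (t *: x + (1 - t) *: y).
Proof.
move=> /andP[t0 t1] Dx Dy.
by have := Dconv (Itv01 t0 t1) (mem_set Dx) (mem_set Dy); rewrite inE.
Qed.

Lemma bdry_notin y : bdry D y -> ~ D y.
Proof. by move=> [_ +] Dy; apply; move/interior_id : Dopen => ->. Qed.

(** Approximate [x] by x' in [D] and compensate by moving [p] to p' = p + ((1 - t)/t)(x - x'), which
    stays in the open set [D] when x' is close to [x]. Then t p' + (1 - t) x' is exactly the
    required point. *)
Lemma closure_open_segment (x p : 'rV[R]_d) (t : R) : closure D x -> D p -> 0 < t <= 1 ->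
  D (x + t *: (p - x)).
Proof.
move=> cx Dp /andP[t0 t1].
have : \forall x' \near x, D (p + ((1 - t) / t) *: (x - x')).
  have h : (fun x' : 'rV[R]_d => p + ((1 - t) / t) *: (x - x')) x' @[x' --> x]
      --> p + ((1 - t) / t) *: (x - x).
    apply: (@cvgD _ _ _ (nbhs x) (nbhs_filter x)); first exact: cvg_cst.
    by apply: cvgZ; [exact: cvg_cst|apply: cvgB; [exact: cvg_cst|exact: cvg_id]].
  by move: h; rewrite subrr scaler0 addr0; apply; exact: open_nbhs_nbhs.
move=> /cx[x' [Dx' Dp']].
have := convex_setP (_ : 0 <= t <= 1) Dp' Dx'; rewrite (ltW t0) => /(_ t1).
congr D; rewrite scalerDr scalerA mulrCA mulfV ?gt_eqF// mulr1.
apply/rowP => k; rewrite !mxE; ring.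
Qed.

End convex_open.

(** * Graph charts and the outward normal *)

Section chart.
Context {R : realType} {m : nat} (D : set 'rV[R]_m.+1).
Hypotheses (Dopen : open D) (Dconv : convex_set D).
Variables (U : set 'rV[R]_m.+1) (i : 'I_m.+1) (s : bool) (phi : 'rV[R]_m -> R).
Hypothesis chartU : @C1_chart R m.+1 D U i s phi.

Let oU : open U. Proof. by case: chartU. Qed.
Let dphi z : differentiable phi z. Proof. by case: chartU => _ [+ _] _; apply. Qed.
Let DE y : U y -> D y <-> (-1) ^+ s * (y 0 i - phi (col' i y)) < 0.
Proof. by case: chartU => _ _; apply. Qed.

Lemma chart_continuous : continuous phi.
Proof. by move=> z; exact: differentiable_continuous. Qed.

Lemma chart_grad_continuous : continuous (grad phi).
Proof. by case: chartU => _ []. Qed.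

Lemma area_density_gt0 z : 0 < area_density phi z.
Proof. by rewrite sqrtr_gt0 ltr_pwDl// dot_ge0. Qed.

Lemma cvg_area_density {T} {F : set_system T} {FF : Filter F} (f : T -> 'rV[R]_m) z :
  f @ F --> z -> area_density phi (f t) @[t --> F] --> area_density phi z.
Proof.
move=> fz; have gz := cvg_comp _ _ fz (@chart_grad_continuous z).
have h : 1 + dot (grad phi (f t)) (grad phi (f t)) @[t --> F] -->
    1 + dot (grad phi z) (grad phi z).
  by apply: cvgD; [exact: cvg_cst|exact: cvg_dot].
exact: (cvg_comp _ _ h (@sqrt_continuous _ _)).
Qed.

Lemma area_density_continuous : continuous (area_density phi).
Proof. by move=> z; exact: (@cvg_area_density _ _ (nbhs_filter z) id z cvg_id). Qed.

(** Defining function of the chart: inside [U] it is negative exactly on [D]. *)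
Let G (y : 'rV[R]_m.+1) := (-1) ^+ s * (y 0 i - phi (col' i y)).

Let cvg_G {T} {F : set_system T} {FF : Filter F} (f : T -> 'rV[R]_m.+1) (y : 'rV[R]_m.+1) :
  f @ F --> y -> G (f t) @[t --> F] --> G y.
Proof.
move=> fy; apply: cvgM; first exact: cvg_cst.
apply: cvgB; first exact: cvg_coord.
have h := cvg_comp _ phi (cvg_col' (i := i) fy) (@chart_continuous (col' i y)); exact: h.
Qed.

Let G_continuous : continuous G.
Proof. by move=> y; exact: (@cvg_G _ _ (nbhs_filter y) id y cvg_id). Qed.

(** A boundary point is outside the open set [D], so G >= 0 there; and G > 0 would persist on a
    neighbourhood, contradicting that the point is in the closure of [D]. *)
Lemma chart_bdry y : bdry D y -> U y -> y 0 i = phi (col' i y).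
Proof.
move=> By Uy; have := bdry_notin Dopen By; rewrite (DE Uy) -/(G y) => /negP.
rewrite -leNgt le_eqVlt => /predU1P[/esym/eqP|Gy].
  by rewrite /G mulf_eq0 signr_eq0/= subr_eq0 => /eqP.
have : nbhs y (U `&` [set y' | 0 < G y']).
  apply: filterI; first exact: open_nbhs_nbhs.
  by have := @G_continuous y => /(_ _ (lt_nbhsr Gy)).
move=> /(proj1 By) [y' [Dy' [Uy' /= Gy']]].
by move: Dy'; rewrite (DE Uy') -/(G y') ltNge ltW.
Qed.

Lemma chart_derive y w : is_derive (0:R) (1:R) (fun e => G (y + e *: w))
  ((-1) ^+ s * (w 0 i - dot (grad phi (col' i y)) (col' i w))).
Proof.
have E : (fun e => G (y + e *: w)) = (-1) ^+ s \*:
    ((cst (y 0 i) + (w 0 i \*: id)) - (fun e => phi (col' i y + e *: col' i w))).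
  apply/funext => e; rewrite /G /= /GRing.scale/= !fctE; congr (_ * (_ - phi _)).
    by rewrite !mxE mulrC.
  by apply/rowP => j; rewrite !mxE.
rewrite E; apply: is_deriveZ; apply: is_deriveB.
  rewrite -[X in is_derive _ _ _ X]add0r; apply: is_deriveD.
  have := @is_deriveZ R _ _ id (w 0 i) (0:R) 1 1.
  rewrite /GRing.scale/= mulr1; apply.
have := @is_derive_line R m phi (col' i y) (col' i w) 0.
by rewrite scale0r addr0; apply.
Qed.

Definition chart_normal y : 'rV[R]_m.+1 := ((-1) ^+ s / area_density phi (col' i y)) *:
  insert_coord i 1 (- grad phi (col' i y)).

(** The numerator is the derivative of [G] along [w] (see [chart_derive]) and the density is
    positive, so the sign of the dot product is that of this derivative. *)
Lemma dot_chart_normal y w : dot w (chart_normal y) =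
  (-1) ^+ s * (w 0 i - dot (grad phi (col' i y)) (col' i w)) / area_density phi (col' i y).
Proof.
rewrite /chart_normal dotZr dot_insert_coord mulr1 (dotC (col' i w)) dotNl.
by rewrite mulrAC.
Qed.

Let near_segment_U y w : U y -> \forall e \near (0:R)^'+, U (y + e *: w).
Proof.
move=> Uy; have h : (fun e : R => y + e *: w) @ (0:R)^'+ --> y + (0:R) *: w.
  apply: cvgD; first exact: cvg_cst.
  by apply: cvgZ; [apply: cvg_at_right_filter; exact: cvg_id|exact: cvg_cst].
by move: h; rewrite scale0r addr0; apply; exact: open_nbhs_nbhs.
Qed.

Lemma chart_inward y w : bdry D y -> U y -> dot w (chart_normal y) < 0 ->
  \forall e \near (0:R)^'+, D (y + e *: w).
Proof.
move=> By Uy; rewrite dot_chart_normal pmulr_llt0 ?invr_gt0 ?area_density_gt0// => neg.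
have Gy : G y = 0 by rewrite /G (chart_bdry By Uy) subrr mulr0.
have dG : is_derive (0:R) (1:R) (fun e => - G (y + e *: w))
    (- ((-1) ^+ s * (w 0 i - dot (grad phi (col' i y)) (col' i w)))).
  exact: is_deriveN (chart_derive y w).
have := derive_gt0_right dG; rewrite scale0r addr0 Gy oppr0 oppr_gt0 => /(_ erefl neg).
apply: filter_app; apply: filterS (near_segment_U w Uy).
by move=> e Ue; rewrite oppr_gt0 => /(DE Ue).
Qed.

(** The tangent hyperplane supports [D]. If a point p of [D] were strictly on its outer side, [G]
    would be positive just after y on the segment to p, while convexity puts these points in [D].
    Continuity of the dot product extends the inequality to the closure. *)
Lemma chart_normal_le0 (y x : 'rV[R]_m.+1) : bdry D y -> U y -> closure D x ->
  dot (x - y) (chart_normal y) <= 0.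
Proof.
move=> By Uy; have inD p : D p -> dot (p - y) (chart_normal y) <= 0.
  move=> Dp; rewrite leNgt; apply/negP.
  rewrite dot_chart_normal pmulr_lgt0 ?invr_gt0 ?area_density_gt0// => pos.
  have Gy : G y = 0 by rewrite /G (chart_bdry By Uy) subrr mulr0.
  have := derive_gt0_right (chart_derive y (p - y)).
  rewrite scale0r addr0 => /(_ Gy pos) Gpos.
  have := @filter_ex _ (0:R)^'+ _ _ (filterI Gpos (filterI (near_segment_U (p - y) Uy)
     (filterI (nbhs_right_gt (0:R)) (nbhs_right_le (@ltr01 R))))).
  move=> [e [Ge [Ue [e0 e1]]]].
  have : D (y + e *: (p - y)).
    by apply: closure_open_segment => //; [case: By|rewrite e0].
  by move=> /(DE Ue); rewrite -/(G _) ltNge ltW.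
move=> cx; rewrite leNgt; apply/negP => pos.
have h : dot (x' - y) (chart_normal y) @[x' --> x] --> dot (x - y) (chart_normal y).
  apply: (@cvg_dot _ _ _ (nbhs_filter x) _ (fun x' => x' - y) (cst _)).
    apply: (@cvgB _ _ _ _ (nbhs_filter x) id (cst y) x y); first exact: cvg_id.
    exact: (@cvg_cst _ _ _ _ (nbhs_filter x)).
  exact: (@cvg_cst _ _ _ _ (nbhs_filter x)).
have /cx[x' [/inD Dx' /=]] := h _ (lt_nbhsr pos).
by rewrite ltNge Dx'.
Qed.

End chart.

(** The inverse is continuous away from 0; the point 0 is split off as a measurable singleton. *)
Lemma measurable_invr (R : realType) : measurable_fun setT (@GRing.inv R).
Proof.
rewrite -(setUv [set (0:R)]); apply/measurable_funU => //.
  exact: measurableC.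
split; first exact: measurable_fun_set1.
apply: open_continuous_measurable_fun; first exact/closed_openC/closed_eq.
by move=> t; rewrite inE/= => /eqP t0; apply: cvgV => //; exact: cvg_id.
Qed.

Lemma cvg_affine_rV (R : realType) d {T : Type} {F : set_system T} {FF : Filter F}
    (f : T -> 'rV[R]_d) (v x : 'rV[R]_d) (a : R) :
  f @ F --> v -> x + a *: f t @[t --> F] --> x + a *: v.
Proof.
move=> fv; apply: cvgD; first exact: cvg_cst.
by apply: cvgZ => //; exact: cvg_cst.
Qed.

(** * Minkowski gauge and exit point of a convex domain seen from a boundary point *)

Section gauge.
Context {R : realType} {d : nat} (D : set 'rV[R]_d) (x : 'rV[R]_d).
Hypotheses (Dopen : open D) (Dconv : convex_set D) (Bx : bdry D x).

(** For c > 0 this is the set c (D - x). *)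
Definition dilate (c : R) : set 'rV[R]_d := [set v | D (x + c^-1 *: v)].

Definition tangent_cone : set 'rV[R]_d := \bigcup_(c in [set c | 0 < c]) dilate c.

(* Off the tangent cone the set is empty and the infimum is 0. *)
Definition gauge (v : 'rV[R]_d) : R := inf [set c | 0 < c /\ dilate c v].

(** On a vector l (y - x) as in [exit_point_ray] it gives back y, the boundary point where the ray
    from [x] leaves [D]. *)
Definition exit_point (v : 'rV[R]_d) : 'rV[R]_d := x + (gauge v)^-1 *: v.

Lemma dilate_open c : open (dilate c).
Proof.
rewrite openE => v Dv.
have h := @cvg_affine_rV _ _ _ _ (nbhs_filter v) id v x c^-1 cvg_id.
by apply: h; exact: open_nbhs_nbhs.
Qed.

Lemma tangent_cone_open : open tangent_cone.
Proof. by apply: bigcup_open => c _; exact: dilate_open. Qed.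

(** The dilates increase with c because the half-open segment from the boundary point [x] to a point
    of [D] stays in [D]. *)
Lemma dilate_le c c' v : 0 < c -> c <= c' -> dilate c v -> dilate c' v.
Proof.
move=> c0 cc' Dv; have c'0 := lt_le_trans c0 cc'.
have := closure_open_segment Dopen Dconv (proj1 Bx) Dv (_ : 0 < c / c' <= 1).
rewrite divr_gt0// ler_pdivrMr// mul1r cc' => /(_ isT).
by rewrite addrAC subrr add0r scalerA mulrAC mulfV ?gt_eqF// mul1r.
Qed.

Let lbS v : lbound [set c | 0 < c /\ dilate c v] 0.
Proof. by move=> c [/ltW]. Qed.

Lemma gauge_ge0 v : 0 <= gauge v.
Proof.
have [S0|/set0P S0] := eqVneq [set c | 0 < c /\ dilate c v] set0.
  by rewrite /gauge S0 inf0.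
by apply: lb_le_inf.
Qed.

Lemma gauge_le c v : 0 < c -> dilate c v -> gauge v <= c.
Proof. by move=> c0 Dv; apply: ge_inf => //; exists 0; exact: lbS. Qed.

(** Writes the sublevel sets with open sets and the complement of an open set, from which
    measurability follows. The first term accounts for the value 0 of the gauge off the cone. *)
Lemma gauge_lt (r : R) : [set v | gauge v < r] =
  (if 0 < r then ~` tangent_cone else set0) `|` \bigcup_(c in [set c | 0 < c < r]) dilate c.
Proof.
apply/seteqP; split => v /=.
  move=> vr; have r0 := le_lt_trans (gauge_ge0 v) vr; rewrite r0.
  have [[c c0 Dv]|nT] := pselect (tangent_cone v); last by left.
  right; have hi : has_inf [set c | 0 < c /\ dilate c v].
    by split; [exists c|exists 0; exact: lbS].
  have rv : 0 < r - gauge v by rewrite subr_gt0.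
  have [c' [c'0 Dc'] c'r] := inf_adherent rv hi.
  by exists c' => //=; rewrite c'0/= (lt_le_trans c'r)// -/(gauge v) subrKC.
move=> [|[c /= /andP[c0 cr] Dv]]; last exact: le_lt_trans (gauge_le c0 Dv) cr.
case: ifPn => // r0 nT; rewrite /gauge (_ : [set c | _] = set0) ?inf0//.
by apply/seteqP; split => // c [c0 Dv]; apply: nT; exists c.
Qed.

Lemma measurable_gauge : measurable_fun setT (gauge : borel_rV R d -> R).
Proof.
apply: (measurability _ (RGenInftyO.measurableE R)) => _ [_ [r ->] <-].
rewrite setTI (_ : _ @^-1` _ = [set v | gauge v < r]); last first.
  by apply/seteqP; split => v /=; rewrite in_itv.
rewrite gauge_lt; apply: measurableU.
  case: ifP => // _; apply: measurableC.
  by apply: measurable_rV_open; exact: tangent_cone_open.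
by apply: measurable_rV_open; apply: bigcup_open => c _; exact: dilate_open.
Qed.

Lemma measurable_exit_point :
  measurable_fun setT (exit_point : borel_rV R d -> borel_rV R d).
Proof.
apply: measurable_fun_rV => k; under eq_fun do rewrite !mxE.
apply: measurable_funD => //; apply: measurable_funM; last exact: measurable_coord.
exact: measurableT_comp (@measurable_invr R) measurable_gauge.
Qed.

Section ray.
Variable y : 'rV[R]_d.
Hypotheses (By : bdry D y) (inward : \forall e \near (0:R)^'+, D (y + e *: (x - y))).

(** The point tested for membership in [D] is x + (l/c)(y - x). At or beyond y it cannot be in [D],
    for then the segment from [x] would put y itself in [D]. Before y, it lies between [x] and a
    point of [D] close to y, supplied by [inward]. *)
Lemma dilate_ray (l c : R) : 0 < l -> 0 < c -> dilate c (l *: (y - x)) <-> l < c.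
Proof.
move=> l0 c0; rewrite /dilate /= scalerA; split.
  move=> Dv; rewrite ltNge; apply/negP => cl.
  have := closure_open_segment Dopen Dconv (proj1 Bx) Dv (_ : 0 < c / l <= 1).
  rewrite divr_gt0// ler_pdivrMr// mul1r cl => /(_ isT).
  rewrite addrAC subrr add0r scalerA (_ : c / l * (c^-1 * l) = 1); last first.
    by field; rewrite !gt_eqF.
  rewrite scale1r.
  by rewrite addrC subrK => /(bdry_notin Dopen By).
(* The point of [D] near y is y + e (x - y) with e < 1 - l/c, so that it is farther from [x] than
   the target. *)
move=> lc; have t1 : 0 < 1 - c^-1 * l by rewrite subr_gt0 mulrC ltr_pdivrMr// mul1r.
have := @filter_ex _ (0:R)^'+ _ _ (filterI inward
   (filterI (nbhs_right_gt (0:R)) (nbhs_right_lt t1))).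
move=> [e [De [e0 e1]]].
have t0 : 0 < c^-1 * l by rewrite mulr_gt0// invr_gt0.
have e1' : 0 < 1 - e by lra.
have := closure_open_segment Dopen Dconv (proj1 Bx) De (_ : 0 < (c^-1 * l) / (1 - e) <= 1).
rewrite divr_gt0// ler_pdivrMr// mul1r => /(_ _); rewrite (_ : c^-1 * l <= 1 - e); last by lra.
move=> /(_ isT); congr (D (_ + _)).
rewrite (_ : y + e *: (x - y) - x = (1 - e) *: (y - x)).
  by rewrite scalerA divfK// gt_eqF.
by apply/rowP => k; rewrite !mxE; ring.
Qed.

Lemma gauge_ray l : 0 < l -> gauge (l *: (y - x)) = l.
Proof.
move=> l0; rewrite /gauge (_ : [set c | _] = `]l, +oo[%classic).
  exact: inf_itv.
apply/seteqP; split => c /=; rewrite in_itv/= andbT.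
  by move=> [c0] /(dilate_ray l0 c0).
by move=> lc; have c0 := lt_trans l0 lc; split => //; exact/dilate_ray.
Qed.

Lemma exit_point_ray l : 0 < l -> exit_point (l *: (y - x)) = y.
Proof.
move=> l0; rewrite /exit_point gauge_ray// scalerA mulVf ?gt_eqF// scale1r.
by rewrite addrC subrK.
Qed.

Lemma tangent_cone_ray l : 0 < l -> tangent_cone (l *: (y - x)).
Proof.
move=> l0; exists (l + 1); first by rewrite /= addr_gt0.
by apply/dilate_ray => //; rewrite ?addr_gt0// ltrDl.
Qed.

End ray.

(* x is the midpoint of x + v / c and x - v / c. *)
Lemma tangent_coneN v : tangent_cone v -> ~ tangent_cone (- v).
Proof.
move=> [c c0 Dc] [c' c'0 Dc'].
have M0 : 0 < Num.max c c' by rewrite lt_max c0.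
have D1 : dilate (Num.max c c') v by apply: dilate_le Dc; rewrite // le_max lexx.
have D2 : dilate (Num.max c c') (- v).
  by apply: dilate_le Dc'; rewrite // le_max lexx orbT.
apply: (bdry_notin Dopen Bx).
have := convex_setP Dconv (_ : 0 <= 2^-1 <= 1) D1 D2.
rewrite invr_ge0 ler0n invf_le1// ler1n => /(_ isT); congr D.
by apply/rowP => k; rewrite !mxE; field; rewrite gt_eqF.
Qed.

End gauge.

(** * The cone inequality *)

Lemma measurable_dot d (T : measurableType d) (R : realType) m
    (f g : T -> borel_rV R m) : measurable_fun setT f -> measurable_fun setT g ->
  measurable_fun setT (fun t => dot (f t) (g t)).
Proof.
move=> mf mg; apply: measurable_sum => k.
by apply: measurable_funM; [exact: (measurableT_comp (measurable_coord k) mf)|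
  exact: (measurableT_comp (measurable_coord k) mg)].
Qed.

Lemma measurable_col' d (T : measurableType d) (R : realType) m (i : 'I_m.+1)
    (f : T -> borel_rV R m.+1) : measurable_fun setT f ->
  measurable_fun setT (fun t => col' i (f t : 'rV[R]_m.+1) : borel_rV R m).
Proof.
move=> mf; apply: measurable_fun_rV => k; under eq_fun do rewrite mxE.
exact: (measurableT_comp (measurable_coord (lift i k)) mf).
Qed.

Lemma measurable_rV_linear d (T : measurableType d) (R : realType) m
    (a : T -> R) (f g : T -> borel_rV R m) :
  measurable_fun setT a -> measurable_fun setT f -> measurable_fun setT g ->
  measurable_fun setT (fun t => a t *: (f t : 'rV[R]_m) + (g t : 'rV[R]_m) : borel_rV R m).
Proof.
move=> ma mf mg; apply: measurable_fun_rV => k; under eq_fun do rewrite !mxE.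
apply: measurable_funD; last exact: (measurableT_comp (measurable_coord k) mg).
by apply: measurable_funM => //; exact: (measurableT_comp (measurable_coord k) mf).
Qed.

Lemma measurable_bdry (R : realType) d (D : set 'rV[R]_d) :
  measurable (bdry D : set (borel_rV R d)).
Proof.
apply: measurableD; first by apply: measurable_rV_closed; exact: closed_closure.
by apply: measurable_rV_open; exact: open_interior.
Qed.

Section chart_integral.
Context {R : realType} {m : nat} (D : set 'rV[R]_m.+1).
Hypotheses (Dopen : open D) (Dconv : convex_set D).
Variables (U : set 'rV[R]_m.+1) (i : 'I_m.+1) (s : bool) (phi : 'rV[R]_m -> R).
Hypothesis chartU : @C1_chart R m.+1 D U i s phi.
Variable S : {measure set (borel_rV R m.+1) -> \bar R}.
Hypothesis hS : surface_measure D S.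
Variable nu : 'rV[R]_m.+1 -> 'rV[R]_m.+1.
Hypothesis hnu : outward_unit_normal D nu.

Definition chart_map (z : 'rV[R]_m) : 'rV[R]_m.+1 := insert_coord i (phi z) z.

Lemma measurable_chart_fun : measurable_fun setT (phi : borel_rV R m -> R).
Proof. by apply: measurable_rV_continuous_real; exact: chart_continuous chartU. Qed.

Lemma measurable_chart_grad : measurable_fun setT (grad phi : borel_rV R m -> borel_rV R m).
Proof. by apply: measurable_rV_continuous; exact: chart_grad_continuous chartU. Qed.

Lemma measurable_area_density : measurable_fun setT (area_density phi : borel_rV R m -> R).
Proof. by apply: measurable_rV_continuous_real; exact: area_density_continuous chartU. Qed.

Lemma measurable_chart_map :
  measurable_fun setT (chart_map : borel_rV R m -> borel_rV R m.+1).
Proof. by apply: measurable_insert_coord => //; exact: measurable_chart_fun. Qed.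

Let measurable_indic_chart A : measurable (A : set (borel_rV R m.+1)) ->
  measurable_fun setT (fun z : borel_rV R m => \1_A (chart_map z) * area_density phi z).
Proof.
move=> mA; apply: measurable_funM; last exact: measurable_area_density.
by apply: measurableT_comp measurable_chart_map; exact: measurable_indic.
Qed.

Let indic_area_ge0 A z : 0 <= \1_A (chart_map z) * area_density phi z.
Proof. by rewrite mulr_ge0// ltW// area_density_gt0. Qed.

Lemma surface_measure_chart (A : set (borel_rV R m.+1)) : measurable A ->
  A `<=` bdry D `&` U ->
  S A = (\int[lebesgue_rV R m]_z (\1_A (chart_map z) * area_density phi z)%:E)%E.
Proof.
move=> mA AU; have [_ /(_ _ _ _ _ chartU A mA AU)] := hS => ->.
rewrite integral_lebesgue_rV//.
  by apply/measurable_EFinP; exact: measurable_indic_chart.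
by move=> z; rewrite lee_fin.
Qed.

(** [surface_measure] prescribes the measure of sets only; [le_integral_indicP], used in both
    directions, turns this into a formula for integrals. *)
Lemma surface_integral_chart (A : set (borel_rV R m.+1)) (h : borel_rV R m.+1 -> \bar R) :
  measurable A -> A `<=` bdry D `&` U ->
  measurable_fun setT h -> (forall y, 0 <= h y)%E ->
  (\int[S]_(y in A) h y = \int[lebesgue_rV R m]_z
     (h (chart_map z) * (\1_A (chart_map z) * area_density phi z)%:E))%E.
Proof.
move=> mA AU mh h0.
have -> : (\int[S]_(y in A) h y = \int[S]_y (h y * (\1_A y)%:E))%E.
  rewrite integral_mkcond; apply: eq_integral => y _.
  by rewrite patchE indicE; case: ifPn; rewrite ?mule1 ?mule0.
have E B : measurable B ->
    (\int[S]_y (\1_B y * \1_A y)%:E =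
     \int[lebesgue_rV R m]_z (\1_B (chart_map z) * (\1_A (chart_map z) * area_density phi z))%:E)%E.
  move=> mB; have mBA := measurableI _ _ mB mA.
  transitivity (S (B `&` A)).
    rewrite -[B `&` A]setIT -integral_indic//.
    by apply: eq_integral => y _; rewrite indicI.
  rewrite surface_measure_chart// => [|y [_ /AU]//].
  by apply: eq_integral => z _; rewrite indicI /= mulrA.
apply/eqP; rewrite eq_le; apply/andP; split.
  apply: (@le_integral_indicP _ _ _ _ _ _ R S (lebesgue_rV R m) id chart_map) => //.
  - exact: measurable_chart_map.
  - exact: measurable_indic_chart.
  - by move=> B /E ->.
apply: (@le_integral_indicP _ _ _ (borel_rV R m) (borel_rV R m.+1) (borel_rV R m.+1) R
  (lebesgue_rV R m) S chart_map id
  (fun z => \1_A (chart_map z) * area_density phi z) (\1_A)) => //.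
- exact: measurable_chart_map.
- exact: measurable_indic_chart.
- by move=> B /E ->.
Qed.

End chart_integral.

Section ray_weight.
Context {R : realType}.

(** The radial density l^(d-1) on the positive half-line, with d = m + 1. *)
Definition ray_weight (m : nat) (l : R) : R := \1_(`]0, +oo[%classic : set R) l * l ^+ m.

Lemma ray_weight_ge0 m l : 0 <= ray_weight m l.
Proof.
rewrite /ray_weight indicE; case: (boolP (_ \in _)); last by rewrite mul0r.
by rewrite inE/= in_itv/= andbT mul1r => /ltW; exact: exprn_ge0.
Qed.

Lemma measurable_ray_weight m : measurable_fun setT (ray_weight m).
Proof.
apply: measurable_funM; first exact: measurable_indic.
exact: measurable_funX.
Qed.

End ray_weight.

Section ray_integral.
Local Open Scope ereal_scope.
Context {R : realType} {m : nat} (x : 'rV[R]_m.+1).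

(** The integral over l in (0, oo) of g(l (y - x)) l^(d-1): the radial part of integration in the
    coordinates (y, l). *)
Definition ray_integral (g : 'rV[R]_m.+1 -> \bar R) (y : 'rV[R]_m.+1) : \bar R :=
  \int[@lebesgue_measure R]_l (g (l *: (y - x))%R * (ray_weight m l)%:E).

Lemma measurable_ray d (T : measurableType d) (l : T -> R) (y : T -> borel_rV R m.+1) :
  measurable_fun setT l -> measurable_fun setT y ->
  measurable_fun setT (fun t => (l t *: ((y t : 'rV[R]_m.+1) - x))%R : borel_rV R m.+1).
Proof.
move=> ml my; apply: measurable_fun_rV => k; under eq_fun do rewrite !mxE.
apply: measurable_funM => //; apply: measurable_funB => //.
exact: (measurableT_comp (measurable_coord k) my).
Qed.

Lemma measurable_ray_integral (g : borel_rV R m.+1 -> \bar R) :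
  measurable_fun setT g -> (forall v, 0 <= g v) ->
  measurable_fun setT (ray_integral g : borel_rV R m.+1 -> \bar R).
Proof.
move=> mg g0.
apply: (@measurable_fun_fubini_tonelli_F _ _ (borel_rV R m.+1) (measurableTypeR R) R
  (@lebesgue_measure R)
  (fun p => g (p.2 *: ((p.1 : 'rV[R]_m.+1) - x))%R * (ray_weight m p.2)%:E)).
- apply: emeasurable_funM; first by apply: measurableT_comp mg _; exact: measurable_ray.
  by apply/measurable_EFinP; apply: measurableT_comp (measurable_ray_weight m) _.
- by move=> p; rewrite mule_ge0// lee_fin ray_weight_ge0.
Qed.

Lemma ray_integral_ge0 (g : 'rV[R]_m.+1 -> \bar R) y :
  (forall v, 0 <= g v) -> 0 <= ray_integral g y.
Proof. by move=> g0; apply: integral_ge0 => l _; rewrite mule_ge0// lee_fin ray_weight_ge0. Qed.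

End ray_integral.

(** * The cone inequality inside one chart *)

Section cone_chart.
Context {R : realType} {m : nat} (D : set 'rV[R]_m.+1).
Hypotheses (Dopen : open D) (Dconv : convex_set D).
Variables (U : set 'rV[R]_m.+1) (i : 'I_m.+1) (s : bool) (phi : 'rV[R]_m -> R).
Hypothesis chartU : @C1_chart R m.+1 D U i s phi.
Variable S : {measure set (borel_rV R m.+1) -> \bar R}.
Hypothesis hS : surface_measure D S.
Variable nu : 'rV[R]_m.+1 -> 'rV[R]_m.+1.
Hypothesis hnu : outward_unit_normal D nu.
Variable x : 'rV[R]_m.+1.
Hypothesis Bx : bdry D x.

Let x' := col' i x.
(** The numerator of (y - x).nu(y) in the chart, up to the sign of the chart; the denominator is the
    area density, which the surface measure cancels. *)
Let Q (z : 'rV[R]_m) : R := phi z - x 0 i - dot (grad phi z) (z - x').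

Let dot_nuE y : bdry D y -> U y ->
  dot (y - x) (nu y) = (-1) ^+ s * Q (col' i y) / area_density phi (col' i y).
Proof.
move=> By Uy; rewrite (hnu chartU By Uy) (dot_chart_normal i s phi y (y - x)) /Q.
rewrite !mxE (chart_bdry Dopen chartU By Uy); congr (_ * (_ - dot _ _) / _).
by apply/rowP => j; rewrite !mxE.
Qed.

Lemma chart_dot_nu_ge0 y : bdry D y -> U y -> 0 <= dot (y - x) (nu y).
Proof.
move=> By Uy; have := chart_normal_le0 Dopen Dconv chartU By Uy (proj1 Bx).
have -> : chart_normal i s phi y = nu y by rewrite (hnu chartU By Uy).
by rewrite -opprB dotNl oppr_le0.
Qed.

Lemma chart_inward_ray y : bdry D y -> U y -> 0 < dot (y - x) (nu y) ->
  \forall e \near (0:R)^'+, D (y + e *: (x - y)).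
Proof.
move=> By Uy pos; apply: (chart_inward Dopen chartU By Uy).
have -> : chart_normal i s phi y = nu y by rewrite (hnu chartU By Uy).
by rewrite -opprB dotNl oppr_lt0.
Qed.

(** For fixed [w], the boundary point above [base w l] satisfies l (y - x) = ([q w l], w), as shown
    in [ray_chart_map]: varying l moves this vector along a line parallel to axis [i]. The speed
    [q'] along that line is [Q] at the base point. *)
Let base (w : 'rV[R]_m) (l : R) : 'rV[R]_m := x' + l^-1 *: w.
Let q (w : 'rV[R]_m) (l : R) : R := l * (phi (base w l) - x 0 i).
Let q' (w : 'rV[R]_m) (l : R) : R :=
  phi (base w l) - x 0 i - l^-1 * dot (grad phi (base w l)) w.

Let Q_base w l : Q (base w l) = q' w l.
Proof. by rewrite /Q /q' /base (addrC x') addrK dotZr. Qed.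

Let is_derive_q w l : l != 0 -> is_derive l (1:R) (q w) (q' w l).
Proof.
move=> l0.
have dphi z : differentiable phi z by case: chartU => _ [+ _] _; apply.
have dV : is_derive l (1:R) (@GRing.inv R) (- l ^- 2 *: 1).
  exact: (@is_deriveV R id l 1 1 l0 (is_derive_id _ _)).
have dp := is_derive_line_comp (dphi (x' + l^-1 *: w)) dV.
have dB := is_deriveB dp (is_derive_cst (x 0 i) l (1:R)).
have dq := is_deriveM (is_derive_id l (1:R)) dB.
apply: (is_derive_eq dq); rewrite /q' /base !fctE /GRing.scale/= !mulr1 subr0.
by field.
Qed.

Let cvg_base w l : l != 0 -> base w l' @[l' --> l] --> base w l.
Proof.
move=> l0; apply: cvgD; first exact: cvg_cst.
by apply: cvgZ; [apply: cvgV => //; exact: cvg_id|exact: cvg_cst].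
Qed.

Let continuous_q' w l : l != 0 -> {for l, continuous (q' w)}.
Proof.
move=> l0; have cb := @cvg_base w l l0.
apply: cvgB.
  apply: cvgB; last exact: cvg_cst.
  have h := cvg_comp _ phi cb (@chart_continuous _ _ _ _ _ _ _ chartU _); exact: h.
apply: cvgM; first by apply: cvgV => //; exact: cvg_id.
apply: cvg_dot; last exact: cvg_cst.
have h := cvg_comp _ (grad phi) cb (@chart_grad_continuous _ _ _ _ _ _ _ chartU _); exact: h.
Qed.

Let measurable_base : measurable_fun setT
  (fun p : measurableTypeR R * borel_rV R m => base p.2 p.1 : borel_rV R m).
Proof.
rewrite (_ : (fun _ => _) = (fun p : measurableTypeR R * borel_rV R m =>
    p.1^-1 *: (p.2 : 'rV[R]_m) + cst x' p : borel_rV R m)); last first.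
  by apply/funext => p; rewrite /base addrC.
apply: measurable_rV_linear => //.
by apply: measurableT_comp measurable_fst; exact: measurable_invr.
Qed.

Let measurable_base1 w : measurable_fun setT (fun l : R => base w l : borel_rV R m).
Proof. exact: (measurableT_comp measurable_base
  (@pair2_measurable _ _ (measurableTypeR R) (borel_rV R m) w)). Qed.

Let measurable_q w : measurable_fun setT (q w).
Proof.
apply: measurable_funM => //; apply: measurable_funB => //.
exact: (measurableT_comp (measurable_chart_fun chartU) (measurable_base1 w)).
Qed.

Let measurable_q' w : measurable_fun setT (q' w).
Proof.
apply: measurable_funB.
  apply: measurable_funB => //.
  exact: (measurableT_comp (measurable_chart_fun chartU) (measurable_base1 w)).
apply: measurable_funM; first exact: measurable_invr.
apply: measurable_dot => //.
exact: (measurableT_comp (measurable_chart_grad chartU) (measurable_base1 w)).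
Qed.

Let measurable_Q : measurable_fun setT (Q : borel_rV R m -> R).
Proof.
apply: measurable_funB.
  by apply: measurable_funB => //; exact: measurable_chart_fun chartU.
apply: measurable_dot; first exact: measurable_chart_grad chartU.
have := measurable_affine_rV 1 (- x'); under eq_fun do rewrite scale1r; exact.
Qed.

Local Open Scope ereal_scope.
Notation leb := (@lebesgue_measure R).

Notation K := (ray_integral x).

Let ray_chart_map w l : l != 0%R ->
  (l *: (chart_map i phi (base w l) - x) = insert_coord i (q w l) w)%R.
Proof.
move=> l0; apply/rowP => k; rewrite !mxE; case: (unliftP i k) => [j|] ->; last by [].
by rewrite !mxE addrC addKr mulrA mulfV// mul1r.
Qed.

(** The points of [A] where (y - x).nu(y) > 0. The ray map is injective only there, and the rest of
    [A] contributes 0 to the surface integral. *)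
Let Apos (A : set (borel_rV R m.+1)) : set (borel_rV R m.+1) :=
  A `&` [set y | (0 < (-1) ^+ s * Q (col' i (y : 'rV[R]_m.+1)))%R].

Let measurable_Apos A : measurable A -> measurable (Apos A).
Proof.
move=> mA; apply: measurableI => //.
have mf : measurable_fun setT
    (fun y : borel_rV R m.+1 => ((-1) ^+ s * Q (col' i (y : 'rV[R]_m.+1)))%R).
  by apply: measurable_funM => //; apply: measurableT_comp measurable_Q _; exact: measurable_col'.
rewrite (_ : [set y | _] = (fun y : borel_rV R m.+1 =>
  ((-1) ^+ s * Q (col' i (y : 'rV[R]_m.+1)))%R) @^-1` `]0%R, +oo[%classic).
  by rewrite -[X in measurable X]setTI; exact: mf.
by apply/seteqP; split => y /=; rewrite in_itv/= andbT.
Qed.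

(** Passes from the surface measure to Lebesgue measure on the chart domain; the two occurrences of
    the area density cancel and leave |Q|. *)
Let cone_chart_surface (A : set (borel_rV R m.+1)) (g : borel_rV R m.+1 -> \bar R) :
  measurable A -> A `<=` bdry D `&` U -> measurable_fun setT g -> (forall v, 0 <= g v) ->
  \int[S]_(y in A) (K g y * (dot (y - x) (nu y))%:E) <=
  \int[lebesgue_rV R m]_z (K g (chart_map i phi z) *
    (\1_(Apos A) (chart_map i phi z) * `|Q z|)%:E).
Proof.
move=> mA AU mg g0.
pose b (y : 'rV[R]_m.+1) : R := (`|Q (col' i y)| / area_density phi (col' i y))%R.
have b0 y : (0 <= b y)%R by rewrite divr_ge0// ltW// area_density_gt0.
have mb : measurable_fun setT (b : borel_rV R m.+1 -> R).
  apply: measurable_funM.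
    apply: measurableT_comp => //.
    by apply: measurableT_comp measurable_Q _; exact: measurable_col'.
  apply: (measurableT_comp (@measurable_invr R)).
  by apply: measurableT_comp (measurable_area_density chartU) _; exact: measurable_col'.
apply: (@le_trans _ _ (\int[S]_(y in Apos A) (K g y * (b y)%:E))).
  rewrite integral_mkcond [leRHS]integral_mkcond; apply: le_ge0_integral => y _.
    rewrite patchE; case: ifPn => // /set_mem /AU[By Uy].
    by rewrite mule_ge0 ?ray_integral_ge0// lee_fin chart_dot_nu_ge0.
  rewrite patchE; case: ifPn => [/set_mem Ay|_]; last first.
    by rewrite patchE; case: ifP => // _; rewrite mule_ge0 ?ray_integral_ge0// lee_fin.
  have [By Uy] := AU _ Ay; rewrite patchE; case: ifPn => [/set_mem[_ /= pos]|].
    apply: lee_wpmul2l; first exact: ray_integral_ge0.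
    rewrite lee_fin dot_nuE// /b ler_wpM2r ?invr_ge0 ?(ltW (area_density_gt0 _ _))//.
    by rewrite (le_trans (ler_norm _))// normrM normr_sign mul1r.
  move=> /negP nA; rewrite (_ : dot _ _ = 0%R) ?mule0//.
  apply/eqP; rewrite eq_le chart_dot_nu_ge0// andbT leNgt; apply/negP => pos.
  apply: nA; apply/mem_set; split => //=; move: pos.
  by rewrite dot_nuE// pmulr_lgt0// invr_gt0 area_density_gt0.
rewrite (surface_integral_chart chartU hS); first last.
- by move=> y; rewrite mule_ge0 ?ray_integral_ge0// lee_fin.
- by apply: emeasurable_funM; [exact: measurable_ray_integral|exact/measurable_EFinP].
- by move=> y [/AU].
- exact: measurable_Apos.
apply: le_ge0_integral => z _.
  by rewrite mule_ge0 ?mule_ge0 ?ray_integral_ge0 ?lee_fin// mulr_ge0// ltW// area_density_gt0.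
rewrite -muleA -EFinM /b /chart_map col'_insert_coord mulrCA mulrC divfK//.
  by rewrite mulrC.
by rewrite gt_eqF// area_density_gt0.
Qed.

(** The area inequality on a single line, with the gauge as left inverse of [q w]. The exit point of
    l (y - x) is y, so the indicator of [A] can be moved from the boundary point to the point of the
    cone. *)
Let cone_chart_slice (A : set (borel_rV R m.+1)) (g : borel_rV R m.+1 -> \bar R) (w : 'rV[R]_m) :
  measurable A -> A `<=` bdry D `&` U -> measurable_fun setT g -> (forall v, 0 <= g v) ->
  \int[leb]_(l in `]0%R, +oo[) (g (insert_coord i (q w l) w) *
     (\1_(Apos A) (chart_map i phi (base w l)) * `|q' w l|)%:E) <=
  \int[leb]_t (g (insert_coord i t w) *
     (\1_A (exit_point D x (insert_coord i t w)))%:E).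
Proof.
move=> mA AU mg g0.
pose E := `]0%R, +oo[%classic `&` (fun l : R => chart_map i phi (base w l)) @^-1` (Apos A).
have mE : measurable E.
  apply: measurableI => //; rewrite -[X in measurable X]setTI.
  have mc := measurableT_comp (measurable_chart_map chartU) (measurable_base1 w).
  by apply: mc => //; exact: measurable_Apos.
have mins : measurable_fun setT (fun t : R => insert_coord i t w : borel_rV R m.+1).
  exact: measurable_insert_coord.
pose h t := g (insert_coord i t w) * (\1_A (exit_point D x (insert_coord i t w)))%:E.
have h0 t : 0 <= h t by rewrite mule_ge0// lee_fin.
have rayE l : E l -> [/\ (0 < l)%R,
    insert_coord i (q w l) w = (l *: (chart_map i phi (base w l) - x))%R,
    A (chart_map i phi (base w l)), bdry D (chart_map i phi (base w l)) &
    \forall e \near (0%R:R)^'+, D (chart_map i phi (base w l) +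
       e *: (x - chart_map i phi (base w l)))%R].
  move=> [/=]; rewrite in_itv/= andbT => l0 [Ay pos]; have [By Uy] := AU _ Ay.
  rewrite ray_chart_map ?gt_eqF//; split=> //.
  apply: chart_inward_ray => //.
  by rewrite dot_nuE// divr_gt0// area_density_gt0.
apply: (@le_trans _ _ (\int[leb]_(l in E) (h (q w l) * `|q' w l|%:E))).
  rewrite integral_mkcond [leRHS]integral_mkcond; apply: le_ge0_integral => l _.
    by rewrite patchE; case: ifP => // _; rewrite mule_ge0// lee_fin mulr_ge0.
  rewrite !patchE; case: ifPn => [/set_mem l0|_]; last first.
    by case: ifP => // _; rewrite mule_ge0.
  have [El|nEl] := pselect (E l); last first.
    rewrite memNset// indicE memNset ?mul0r ?mule0//.
    by move=> Al; apply: nEl.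
  have Al : Apos A (chart_map i phi (base w l)) := proj2 El.
  rewrite mem_set// indicE (mem_set Al) mul1r /h.
  have [lp -> Ay By inw] := rayE _ El.
  by rewrite (exit_point_ray Dopen Dconv Bx By inw lp) indicE (mem_set Ay) mule1.
apply: (@area_inequality R (q w) (q' w) (measurable_q w) (measurable_q' w)
  (fun t => gauge D x (insert_coord i t w)) `]0%R, +oo[%classic) => //.
- exact: (measurableT_comp (measurable_gauge x Dopen) mins).
- by move=> l [].
- by move=> l /=; rewrite in_itv/= andbT => l0; apply: is_derive_q; rewrite gt_eqF.
- by move=> l /=; rewrite in_itv/= andbT => l0; apply: continuous_q'; rewrite gt_eqF.
- by move=> l /rayE[l0 -> _ By inw]; rewrite (gauge_ray Dopen Dconv Bx By inw l0).
- apply: emeasurable_funM; first exact: measurableT_comp mg mins.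
  apply/measurable_EFinP; apply: (measurableT_comp (measurable_indic mA)).
  exact: measurableT_comp (measurable_exit_point x Dopen) mins.
Qed.

(** The substitution z = x' + w/l has Jacobian l^(-m), which absorbs the radial weight l^m. *)
Let cone_chart_rescale (A : set (borel_rV R m.+1)) (g : borel_rV R m.+1 -> \bar R) (l : R) :
  measurable A -> measurable_fun setT g -> (forall v, 0 <= g v) -> (0 < l)%R ->
  \int[lebesgue_rV R m]_z (g (l *: (chart_map i phi z - x))%R * (l ^+ m)%:E *
    (\1_(Apos A) (chart_map i phi z) * `|Q z|)%:E) =
  \int[lebesgue_rV R m]_w (g (insert_coord i (q w l) w) *
    (\1_(Apos A) (chart_map i phi (base w l)) * `|q' w l|)%:E).
Proof.
move=> mA mg g0 l0.
pose Phi (z : borel_rV R m) := g (l *: (chart_map i phi z - x))%R *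
  (\1_(Apos A) (chart_map i phi z) * `|Q z|)%:E.
have Phi0 z : 0 <= Phi z by rewrite mule_ge0// lee_fin mulr_ge0.
have mPhi : measurable_fun setT Phi.
  apply: emeasurable_funM.
    apply: measurableT_comp mg _; apply: measurable_ray => //.
    exact: measurable_chart_map chartU.
  apply/measurable_EFinP; apply: measurable_funM.
    apply: (measurableT_comp (measurable_indic (measurable_Apos mA))).
    exact: measurable_chart_map chartU.
  by apply: measurableT_comp => //; exact: measurable_Q.
transitivity ((l ^+ m)%:E * \int[lebesgue_rV R m]_z Phi z).
  rewrite -ge0_integralZl//; last by rewrite lee_fin exprn_ge0// ltW.
  by apply: eq_integral => z _; rewrite /Phi muleA (muleC (l ^+ m)%:E).
have ln0 : (l^-1 != 0)%R by rewrite invr_eq0 gt_eqF.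
rewrite -(integral_rV_affine x' ln0 mPhi Phi0) muleA -EFinM.
rewrite normfV -exprMn gtr0_norm// mulfV ?gt_eqF// expr1n mul1e.
apply: eq_integral => w _; rewrite addrC -/(base w l) /Phi.
by rewrite ray_chart_map ?gt_eqF// Q_base.
Qed.

(** Tonelli puts l outside so that z can be rescaled for fixed l, then puts l back inside so that
    the slice inequality applies for fixed w. The indicator on the right keeps the part of the cone
    reached from [A], which makes the bound additive in [A]. *)
Lemma cone_inequality_chart (A : set (borel_rV R m.+1)) (g : borel_rV R m.+1 -> \bar R) :
  measurable A -> A `<=` bdry D `&` U -> measurable_fun setT g -> (forall v, 0 <= g v) ->
  \int[S]_(y in A) (ray_integral x g y * (dot (y - x) (nu y))%:E) <=
  \int[lebesgue_rV R m.+1]_v (g v * (\1_A (exit_point D x v))%:E).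
Proof.
move=> mA AU mg g0.
apply: le_trans (cone_chart_surface mA AU mg g0) _.
have mAp := measurable_Apos mA.
pose c (z : borel_rV R m) : R := (\1_(Apos A) (chart_map i phi z) * `|Q z|)%R.
have c0 z : (0 <= c z)%R by rewrite mulr_ge0.
have mc : measurable_fun setT c.
  apply: measurable_funM.
    by apply: (measurableT_comp (measurable_indic mAp)); exact: measurable_chart_map chartU.
  by apply: measurableT_comp => //; exact: measurable_Q.
pose F (p : borel_rV R m * measurableTypeR R) :=
  g (p.2 *: (chart_map i phi p.1 - x))%R * (ray_weight m p.2)%:E * (c p.1)%:E.
have F0 p : 0 <= F p by rewrite mule_ge0 ?mule_ge0 ?lee_fin// ray_weight_ge0.
have mgray : measurable_fun setT (fun p : borel_rV R m * measurableTypeR R =>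
    g (p.2 *: (chart_map i phi p.1 - x))%R).
  apply: measurableT_comp mg _; apply: measurable_ray => //.
  exact: (measurableT_comp (measurable_chart_map chartU) measurable_fst).
have mF : measurable_fun setT F.
  apply: emeasurable_funM; last by apply/measurable_EFinP; exact: measurableT_comp mc measurable_fst.
  apply: emeasurable_funM => //; apply/measurable_EFinP.
  exact: (measurableT_comp (measurable_ray_weight m) measurable_snd).
have -> : \int[lebesgue_rV R m]_z (K g (chart_map i phi z) * (c z)%:E) =
    \int[lebesgue_rV R m]_z \int[leb]_l F (z, l).
  apply: eq_integral => z _; rewrite /ray_integral -ge0_integralZr ?lee_fin//.
  - apply: emeasurable_funM; last by apply/measurable_EFinP; exact: measurable_ray_weight.
    by apply: measurableT_comp mg _; exact: measurable_ray.
  - by move=> l _; rewrite mule_ge0// lee_fin ray_weight_ge0.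
rewrite (@fubini_tonelli _ _ _ _ R (lebesgue_rV R m) leb F)//.
(* The integrand after the scaling, in the variables l and w; [F] is the same quantity in z and
   l. *)
pose H (p : measurableTypeR R * borel_rV R m) :=
  (g (insert_coord i (q p.2 p.1) p.2) * (c (base p.2 p.1))%:E) *
   (\1_(`]0%R, +oo[%classic : set R) p.1)%:E.
have H0 p : 0 <= H p by rewrite mule_ge0 ?mule_ge0 ?lee_fin.
have mbase := measurable_base.
have mH : measurable_fun setT H.
  apply: emeasurable_funM.
    apply: emeasurable_funM.
      apply: measurableT_comp mg _; apply: measurable_insert_coord => //.
      apply: measurable_funM => //; apply: measurable_funB => //.
      exact: (measurableT_comp (measurable_chart_fun chartU) mbase).
    by apply/measurable_EFinP; exact: (measurableT_comp mc mbase).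
  apply/measurable_EFinP; apply: (measurableT_comp _ measurable_fst).
  exact: measurable_indic.
have -> : \int[leb]_l \int[lebesgue_rV R m]_z F (z, l) =
    \int[leb]_l \int[lebesgue_rV R m]_w H (l, w).
  apply: eq_integral => l _; rewrite /F /H /= /ray_weight.
  have [l0|l0] := ltP 0%R l; last first.
    have -> : \1_(`]0%R, +oo[%classic : set R) l = 0%R :> R.
      by rewrite indicE memNset//= in_itv/= andbT ltNge l0.
    rewrite mul0r; under eq_integral do rewrite mule0 mul0e.
    by under [RHS]eq_integral do rewrite mule0.
  have -> : \1_(`]0%R, +oo[%classic : set R) l = 1%R :> R.
    by rewrite indicE mem_set//= in_itv/= andbT.
  rewrite mul1r cone_chart_rescale//.
  by apply: eq_integral => w _; rewrite mule1 /c Q_base.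
rewrite (@fubini_tonelli _ _ _ _ R leb (lebesgue_rV R m) H)//.
rewrite (integral_rV_insert_swap i); first last.
- by move=> v; rewrite mule_ge0// lee_fin.
- apply: emeasurable_funM => //; apply/measurable_EFinP.
  exact: (measurableT_comp (measurable_indic mA) (measurable_exit_point x Dopen)).
apply: le_ge0_integral => w _; first exact: integral_ge0.
apply: le_trans (cone_chart_slice w mA AU mg g0).
rewrite [leRHS]integral_mkcond; apply: le_ge0_integral => l _ //.
rewrite /H /= patchE indicE; case: ifPn => [_|_]; last by rewrite mule0.
by rewrite mule1 /c Q_base.
Qed.

End cone_chart.

(** * From charts to the whole boundary by compactness *)

Section boundary.
Context {R : realType} {m : nat} (D : set 'rV[R]_m.+1).
Hypotheses (Dopen : open D) (Dbnd : bounded_set D) (Dconv : convex_set D)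
  (DC1 : C1_boundary D).
Variable S : {measure set (borel_rV R m.+1) -> \bar R}.
Hypothesis hS : surface_measure D S.
Variable nu : 'rV[R]_m.+1 -> 'rV[R]_m.+1.
Hypothesis hnu : outward_unit_normal D nu.

Lemma closure_bounded : exists M : R, forall v, closure D v -> `|v| <= M.
Proof.
have [M [_ DM]] := Dbnd; exists (M + 1) => v cv.
have cl : closed [set u : 'rV[R]_m.+1 | `|u| <= M + 1].
  rewrite (_ : [set u | _] = (@Num.Def.normr _ 'rV[R]_m.+1) @^-1` [set r | r <= M + 1])//.
  by apply: closed_comp => // u _; exact: norm_continuous.
by apply: cl; apply: closure_subset cv => u Du; apply: DM => //; rewrite ltrDl.
Qed.

Lemma bdry_compact : compact (bdry D).
Proof.
apply: bounded_closed_compact.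
  have [M DM] := closure_bounded.
  exists M; split; first exact: num_real.
  by move=> r Mr v [/DM vM _]; exact: le_trans (ltW Mr).
by apply: closedI; [exact: closed_closure|exact/open_closedC/open_interior].
Qed.

(** By compactness finitely many of the neighbourhoods cover the boundary. Induction on this list
    cuts [A] into its part in the first neighbourhood and the remainder, which the others still
    cover. *)
Lemma bdry_local_induction (P : set (borel_rV R m.+1) -> Prop) :
  P set0 ->
  (forall A B : set (borel_rV R m.+1), measurable A -> measurable B -> A `<=` bdry D -> B `<=` bdry D ->
     A `&` B = set0 -> P A -> P B -> P (A `|` B)) ->
  (forall x, bdry D x -> exists V, [/\ open V, V x &
     forall A : set (borel_rV R m.+1), measurable A -> A `<=` bdry D `&` V -> P A]) ->
  forall A : set (borel_rV R m.+1), measurable A -> A `<=` bdry D -> P A.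
Proof.
move=> P0 PU Ploc.
have /choice[V VP] : forall x, exists V, bdry D x -> [/\ open V, V x &
     forall A : set (borel_rV R m.+1), measurable A -> A `<=` bdry D `&` V -> P A].
  move=> x; have [Bx|nBx] := pselect (bdry D x); last by exists setT.
  by have [V ?] := Ploc x Bx; exists V.
have := bdry_compact; rewrite compact_cover => /(_ _ (bdry D) V).
case=> [x /VP[]//|x Bx|F FB cF]; first by exists x => //; have [] := VP _ Bx.
have {}cF : bdry D `<=` \bigcup_(x in [set` finmap.enum_fset F]) V x by exact: cF.
have {}FB x : x \in finmap.enum_fset F -> bdry D x by move=> xF; have := FB x xF; rewrite inE.
move=> A mA AB; have : A `<=` \bigcup_(x in [set` finmap.enum_fset F]) V x by exact: subset_trans AB cF.
elim: (finmap.enum_fset F) FB A mA AB => [_ A mA AB|x r ih FB A mA AB Ar].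
  by move=> Ar; rewrite (_ : A = set0)//; apply/seteqP; split => // v /Ar[].
have [oV Vx PV] := VP x (FB x (mem_head _ _)).
have mV := measurable_rV_open oV.
have -> : A = (A `&` V x) `|` (A `\` V x).
  by apply/seteqP; split => v; [have [|] := pselect (V x v); [left|right]|case=> -[]].
apply: PU.
- exact: measurableI.
- exact: measurableD.
- by move=> v [/AB].
- by move=> v [/AB].
- by apply/seteqP; split => // v [[_ Vv] [_ /(_ Vv)]].
- by apply: PV; [exact: measurableI|move=> v [/AB]].
- apply: ih; first by move=> y yr; apply: FB; rewrite in_cons yr orbT.
  + exact: measurableD.
  + by move=> v [/AB].
  + move=> v [Av nVv]; have [y] := Ar v Av; rewrite /= in_cons => /orP[/eqP ->//|yr Vy].
    by exists y.
Qed.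

(** Near each boundary point the area density is bounded by continuity, and the chart domain over
    the bounded boundary lies in a cube of finite Lebesgue measure. Finiteness is what allows
    Tonelli with the surface measure. *)
Lemma surface_measure_finite : (S (bdry D) < +oo)%E.
Proof.
have [M DM] := closure_bounded.
pose N := (Num.truncn M).+1.
apply: (@bdry_local_induction (fun A => (S A < +oo)%E)) => //.
- by rewrite measure0.
- move=> A B mA mB _ _ AB SA SB; rewrite measureU//; exact: lte_add_pinfty.
- move=> x Bx; have [U [i [s [phi [Ux chartU]]]]] := DC1 Bx.
  pose a := area_density phi (col' i x) + 1.
  exists (U `&` [set y | area_density phi (col' i y) < a]); split.
  + apply: openI; first by case: chartU.
    apply: (@open_comp _ _ (fun y => area_density phi (col' i y)) [set r | r < a]).
      move=> y _; have h := @cvg_col' _ _ _ (nbhs_filter y) _ i id y cvg_id.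
      exact: (@cvg_area_density _ _ _ _ _ _ _ chartU _ _ (nbhs_filter y) _ _ h).
    exact: open_lt.
  + by split => //=; rewrite ltrDl.
  + move=> A mA AV; rewrite (surface_measure_chart chartU hS)// => [|y /AV[? []]//].
    apply: (@le_lt_trans _ _ (\int[lebesgue_rV R m]_z (a * \1_(cube R m N) z)%:E)%E).
      apply: le_ge0_integral => z _.
        by rewrite lee_fin mulr_ge0// ltW// area_density_gt0.
      rewrite lee_fin [leLHS]mulrC indicE.
      have [/set_mem Az|_] := boolP (_ \in A); last first.
        by rewrite mulr0 mulr_ge0// addr_ge0// ltW// area_density_gt0.
      have [[By _] [_ /=]] := AV _ Az; rewrite col'_insert_coord mulr1 => za.
      rewrite indicE mem_set ?mulr1; first exact: ltW.
      move=> k; have /DM := By.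
      move=> yM; apply: (@le_trans _ _ M); last exact/ltW/truncnS_gt.
      apply: le_trans yM.
      have -> : z 0 k = chart_map i phi z 0 (lift i k) by rewrite mxE liftK.
      rewrite [leRHS]/Num.Def.normr/= mx_normrE; apply/bigmax_geP; right => /=.
      by exists (ord0, lift i k).
    under eq_integral do rewrite EFinM.
    rewrite ge0_integralZl_EFin//; last 2 first.
    * by apply/measurable_EFinP; apply: measurable_indic; exact: measurable_cube.
    * by rewrite addr_ge0// ltW// area_density_gt0.
    rewrite integral_indic ?setIT//; last exact: measurable_cube.
    rewrite lte_mul_pinfty// ?lee_fin; last exact: lebesgue_rV_cube.
    by rewrite addr_ge0// ltW// area_density_gt0.
- exact: measurable_bdry.
Qed.

(** [outward_unit_normal] is a pointwise condition; measurability comes from the continuity of the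
    chart data in the explicit formula. *)
Lemma measurable_nu : measurable_fun (bdry D : set (borel_rV R m.+1))
  (nu : borel_rV R m.+1 -> borel_rV R m.+1).
Proof.
apply: (@bdry_local_induction (fun A => measurable_fun A (nu : borel_rV R m.+1 -> borel_rV R m.+1))) => //.
- exact: measurable_fun_set0.
- by move=> A B mA mB _ _ _ nA nB; exact/measurable_funU.
- move=> x Bx; have [U [i [s [phi [Ux chartU]]]]] := DC1 Bx.
  exists U; split => //; first by case: chartU.
  move=> A mA AU.
  apply: (@eq_measurable_fun _ _ _ _ _ (chart_normal i s phi : borel_rV R m.+1 -> borel_rV R m.+1)).
    by move=> y /set_mem /AU[By Uy]; rewrite (hnu chartU By Uy).
  apply: measurable_funTS; rewrite /chart_normal.
  have mc : measurable_fun setT (fun y : borel_rV R m.+1 => col' i (y : 'rV[R]_m.+1) : borel_rV R m).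
    exact: measurable_col'.
  apply: measurable_fun_rV => k; under eq_fun do rewrite !mxE.
  apply: measurable_funM.
    apply: measurable_funM => //; apply: (measurableT_comp (@measurable_invr R)).
    exact: (measurableT_comp (measurable_area_density chartU) mc).
  case: (unlift i k) => [j|] //; under eq_fun do rewrite mxE.
  apply: measurableT_comp => //.
  exact: (measurableT_comp (measurable_coord j) (measurableT_comp (measurable_chart_grad chartU) mc)).
- exact: measurable_bdry.
Qed.

Lemma dot_nu_ge0 x y : bdry D x -> bdry D y -> 0 <= dot (y - x) (nu y).
Proof.
move=> Bx By; have [U [i [s [phi [Uy chartU]]]]] := DC1 By.
exact: (chart_dot_nu_ge0 Dopen Dconv chartU hnu Bx By Uy).
Qed.

Lemma bdry_ray x y (l : R) : bdry D x -> bdry D y -> 0 < dot (y - x) (nu y) -> 0 < l ->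
  [/\ gauge D x (l *: (y - x)) = l, exit_point D x (l *: (y - x)) = y &
      tangent_cone D x (l *: (y - x))].
Proof.
move=> Bx By pos l0; have [U [i [s [phi [Uy chartU]]]]] := DC1 By.
have inw := chart_inward_ray Dopen chartU hnu By Uy pos.
by split; [exact: gauge_ray|exact: exit_point_ray|exact: tangent_cone_ray].
Qed.

Lemma measurable_dot_nu x : measurable_fun (bdry D : set (borel_rV R m.+1))
  (fun y : borel_rV R m.+1 => dot ((y : 'rV[R]_m.+1) - x) (nu y)).
Proof.
apply: measurable_sum => k; apply: measurable_funM.
  apply: measurable_funTS; under eq_fun do rewrite !mxE.
  by apply: measurable_funB => //; exact: measurable_coord.
exact: (measurableT_comp (measurable_coord k) measurable_nu).
Qed.

(** Both sides are additive over disjoint pieces of the boundary: each v has a single exit point,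
    hence is counted for at most one piece. This is how injectivity across different charts
    enters. *)
Lemma cone_inequality x (g : borel_rV R m.+1 -> \bar R) : bdry D x ->
  measurable_fun setT g -> (forall v, 0 <= g v)%E ->
  (\int[S]_(y in (bdry D : set (borel_rV R m.+1)))
     (ray_integral x g y * (dot (y - x) (nu y))%:E) <=
   \int[lebesgue_rV R m.+1]_v (g v * (\1_(bdry D) (exit_point D x v))%:E))%E.
Proof.
move=> Bx mg g0.
pose f (y : borel_rV R m.+1) := (ray_integral x g y * (dot ((y : 'rV[R]_m.+1) - x) (nu y))%:E)%E.
have mf : measurable_fun (bdry D : set (borel_rV R m.+1)) f.
  apply: emeasurable_funM; first by apply: measurable_funTS; exact: measurable_ray_integral.
  by apply/measurable_EFinP; exact: measurable_dot_nu.
have f0 y : bdry D y -> (0 <= f y)%E.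
  by move=> By; rewrite mule_ge0 ?ray_integral_ge0// lee_fin dot_nu_ge0.
have me A : measurable (A : set (borel_rV R m.+1)) -> measurable_fun setT
    (fun v : borel_rV R m.+1 => (g v * (\1_A (exit_point D x v))%:E)%E).
  move=> mA; apply: emeasurable_funM => //; apply/measurable_EFinP.
  exact: (measurableT_comp (measurable_indic mA) (measurable_exit_point x Dopen)).
apply: (@bdry_local_induction (fun A => (\int[S]_(y in A) f y <=
   \int[lebesgue_rV R m.+1]_v (g v * (\1_A (exit_point D x v))%:E))%E)) => //.
- by rewrite integral_set0; apply: integral_ge0 => v _; rewrite mule_ge0// lee_fin.
- move=> A B mA mB AD BD AB0 iA iB.
  have ABD : A `|` B `<=` bdry D by move=> v [/AD|/BD].
  rewrite ge0_integral_setU//; last 3 first.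
  + exact: measurable_funS (measurable_bdry D) ABD mf.
  + by move=> y /ABD /f0.
  + by apply/disj_setPS; rewrite AB0.
  apply: le_trans (leeD iA iB) _; rewrite -ge0_integralD//; last 4 first.
  + by move=> v _; rewrite mule_ge0// lee_fin.
  + exact: me.
  + by move=> v _; rewrite mule_ge0// lee_fin.
  + exact: me.
  apply: le_ge0_integral => v _; first by rewrite adde_ge0// mule_ge0// lee_fin.
  rewrite -ge0_muleDr ?lee_fin// -EFinD lee_wpmul2l// lee_fin !indicE in_setU.
  have [/set_mem Ae|_] := boolP (_ \in A); last by rewrite add0r.
  have [/set_mem Be|_] := boolP (_ \in B); last by rewrite addr0.
  by have : (A `&` B) (exit_point D x v) by []; rewrite AB0.
- move=> z Bz; have [U [i [s [phi [Uz chartU]]]]] := DC1 Bz.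
  exists U; split => //; first by case: chartU.
  move=> A mA AU.
  exact: (cone_inequality_chart Dopen Dconv chartU hS hnu Bx mA AU mg g0).
- exact: measurable_bdry.
Qed.

End boundary.

(** * The heat kernel and the bound C(T) < 1/2 *)

Section gaussian.
Context {R : realType}.
Local Open Scope ereal_scope.
Notation leb := (@lebesgue_measure R).

(** Turns the half-integer powers of the heat kernel into natural powers of a square root, on which
    [field] can operate. *)
Lemma sqrt_powR (a : R) n : (0 <= a)%R -> (a `^ (n%:R / 2) = Num.sqrt a ^+ n)%R.
Proof. by move=> a0; rewrite mulrC powRrM powR12_sqrt// powR_mulrn// sqrtr_ge0. Qed.

Lemma dot_insert2 m (i : 'I_m.+1) (a : R) (z : 'rV[R]_m) :
  dot (insert_coord i a z) (insert_coord i a z) = (a ^+ 2 + dot z z)%R.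
Proof. by rewrite dot_insert_coord insert_coordE col'_insert_coord expr2. Qed.

Lemma integral_gauss1 : \int[leb]_t (expR (- (t ^+ 2 / 4)))%:E = (2 * Num.sqrt pi)%:E.
Proof.
have h2 : (2^-1 != 0 :> R)%R by rewrite invr_eq0 pnatr_eq0.
have mg : measurable_fun setT (fun t : R => (gauss_fun t)%:E).
  by apply/measurable_EFinP; exact: measurable_gauss_fun.
have := integral_affine 0 h2 mg (fun t => gauss_fun_ge0 t).
rewrite integralT_gauss => h; rewrite EFinM -h muleA -EFinM normfV ger0_norm//.
rewrite mulfV ?pnatr_eq0// mul1e; apply: eq_integral => t _.
by rewrite /gauss_fun addr0; congr (expR _)%:E; field.
Qed.

Lemma measurable_dot_self m : measurable_fun setT (fun v : borel_rV R m => dot v v).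
Proof. exact: measurable_dot. Qed.

Lemma measurable_expdot m :
  measurable_fun setT (fun v : borel_rV R m => expR (- (dot v v / 4))).
Proof.
apply: measurableT_comp => //; apply: measurableT_comp => //.
by apply: measurable_funM => //; exact: measurable_dot_self.
Qed.

Lemma integral_gauss_rV m :
  \int[lebesgue_rV R m]_v (expR (- (dot v v / 4)))%:E = ((2 * Num.sqrt pi) ^+ m)%:E.
Proof.
elim: m => [|m ih].
  rewrite integral_lebesgue_rV//=; last by apply/measurable_EFinP; exact: measurable_expdot.
  by rewrite /dot big_ord0 mul0r oppr0 expR0 expr0.
rewrite (integral_rV_insert ord0)//=; last by apply/measurable_EFinP; exact: measurable_expdot.
transitivity (\int[leb]_t ((expR (- (t ^+ 2 / 4)))%:E * ((2 * Num.sqrt pi) ^+ m)%:E)).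
  apply: eq_integral => t _; rewrite -ih -ge0_integralZl//; last first.
    by apply/measurable_EFinP; exact: measurable_expdot.
  apply: eq_integral => z _; rewrite dot_insert2 -EFinM -expRD; congr (expR _)%:E.
  by rewrite mulrDl opprD.
rewrite ge0_integralZr//.
- by rewrite integral_gauss1 -EFinM exprS.
- apply/measurable_EFinP; apply: measurableT_comp => //; apply: measurableT_comp => //.
  by apply: measurable_funM => //; exact: measurable_funX.
Qed.

(** The heat kernel G(v, 1); the factor (4 pi)^(-d/2) is written as the inverse of (2 sqrt pi)^d. *)
Definition gauss_kernel d (v : 'rV[R]_d) : R :=
  ((2 * Num.sqrt pi) ^+ d)^-1 * expR (- (dot v v / 4)).

Lemma gauss_kernel_ge0 d (v : 'rV[R]_d) : (0 <= gauss_kernel v)%R.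
Proof.
by rewrite mulr_ge0 ?expR_ge0// invr_ge0 exprn_ge0// mulr_ge0// sqrtr_ge0.
Qed.

Lemma measurable_gauss_kernel d :
  measurable_fun setT (@gauss_kernel d : borel_rV R d -> R).
Proof. by apply: measurable_funM => //; exact: measurable_expdot. Qed.

Lemma gauss_kernelN d (v : 'rV[R]_d) : gauss_kernel (- v) = gauss_kernel v.
Proof. by rewrite /gauss_kernel dotNl dotC dotNl opprK. Qed.

Lemma integral_gauss_kernel d : \int[lebesgue_rV R d]_v (gauss_kernel v)%:E = 1.
Proof.
under eq_integral do rewrite EFinM.
rewrite ge0_integralZl//; last by apply/measurable_EFinP; exact: measurable_expdot.
rewrite integral_gauss_rV -EFinM mulVf// expf_neq0// mulf_neq0//.
by rewrite sqrtr_eq0 -ltNge pi_gt0.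
Qed.

Lemma lebesgue_rV_affine d (a : R) (c : 'rV[R]_d) (A : set (borel_rV R d)) :
  a != 0%R -> measurable A ->
  (`|a| ^+ d)%:E * lebesgue_rV R d [set v | A (a *: (v : 'rV[R]_d) + c)%R] =
  lebesgue_rV R d A.
Proof.
move=> a0 mA; have mf := @measurable_affine_rV R d a c.
have mB : measurable [set v : borel_rV R d | A (a *: (v : 'rV[R]_d) + c)%R].
  by rewrite -[X in measurable X]setTI; exact: mf.
rewrite -[X in _ * lebesgue_rV R d X]setIT -integral_indic//.
rewrite -[in RHS](setIT A) -integral_indic//.
rewrite -(integral_rV_affine c a0 (g := fun v => (\1_A v)%:E))//; last first.
  by apply/measurable_EFinP; exact: measurable_indic.
Qed.

(* A null open set would make every cube null by scaling, hence the Gaussian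
   integral 0. *)
Lemma lebesgue_rV_open_gt0 d (D : set 'rV[R]_d) : open D -> D !=set0 ->
  0 < lebesgue_rV R d (D : set (borel_rV R d)).
Proof.
move=> oD [p Dp]; rewrite lt0e measure_ge0 andbT; apply/eqP => D0.
have mD := measurable_rV_open oD.
have /nbhs_ballP[e /= e0 eD] : nbhs p D by exact: open_nbhs_nbhs.
have cube0 n : lebesgue_rV R d (cube R d n) = 0.
  have a0 : (e / n.+1%:R != 0)%R by rewrite mulf_neq0 ?invr_eq0 ?gt_eqF.
  have := lebesgue_rV_affine p a0 mD; rewrite D0 => /eqP.
  rewrite mule_eq0 eqe expf_eq0 normr_eq0 (negbTE a0) andbF/= => /eqP A0.
  apply: (@subset_measure0 _ _ _ _ _ _ _ _ _ A0).
  - exact: measurable_cube.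
  - by rewrite -[X in measurable X]setTI; exact: measurable_affine_rV.
  move=> v vn /=; apply: eD; apply/rV_ball_coordP => // k; rewrite !mxE.
  rewrite opprD addrCA subrr addr0 normrN normrM ger0_norm; last by rewrite divr_ge0// ltW.
  rewrite mulrAC ltr_pdivrMr// ltr_pM2l//.
  by apply: le_lt_trans (vn k) _; rewrite ltr_nat.
have T0 : lebesgue_rV R d setT = 0.
  apply/negligibleP => //; rewrite -bigcup_cube; apply: negligible_bigcup => n.
  by apply/negligibleP; [exact: measurable_cube|exact: cube0].
have := integral_gauss_kernel d; rewrite null_set_integral//.
  by move=> /eqP; rewrite eqe eq_sym oner_eq0.
by apply/measurable_EFinP; exact: measurable_gauss_kernel.
Qed.

End gaussian.

(** * The substitution in the time integral of the kernel *)

Section heat_time_integral.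
Context {R : realType} {m : nat} (z : 'rV[R]_m.+1) (T : R).
Hypothesis T0 : 0 < T.

Let r (tau : R) : R := Num.sqrt (T - tau).
(** The new variable l = (T - tau)^(-1/2), whose derivative is l^3 / 2. *)
Let q (tau : R) : R := (r tau)^-1.
Let q' (tau : R) : R := 2^-1 * q tau ^+ 3.

Let r_gt0 tau : tau < T -> 0 < r tau.
Proof. by move=> tT; rewrite sqrtr_gt0 subr_gt0. Qed.

Let r_sqr tau : tau < T -> r tau ^+ 2 = T - tau.
Proof. by move=> tT; rewrite sqr_sqrtr// subr_ge0 ltW. Qed.

Let is_derive_q tau : tau < T -> is_derive tau (1:R) q (q' tau).
Proof.
move=> tT; have rp := r_gt0 tT.
have dT := is_deriveB (is_derive_cst T tau (1:R)) (is_derive_id tau (1:R)).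
have Tt : 0 < (cst T - id) tau by rewrite /= !fctE subr_gt0.
have dr := is_derive1_comp (is_derive1_sqrt Tt) dT.
have rn0 : r tau != 0 by rewrite gt_eqF.
have dq := @is_deriveV R r tau _ 1 rn0 dr.
apply: (is_derive_eq dq).
rewrite /q' /q !fctE -/(r tau) /GRing.scale/= sub0r; field.
exact: rn0.
Qed.

Let cvg_q tau : tau < T -> {for tau, continuous q}.
Proof.
by move=> tT; apply/differentiable_continuous/derivable1_diffP; case: (is_derive_q tT).
Qed.

Let measurable_q : measurable_fun setT q.
Proof.
apply: (measurableT_comp (@measurable_invr R)).
apply: measurableT_comp; last exact: measurable_funB.
by apply: continuous_measurable_fun; exact: sqrt_continuous.
Qed.

(** Parabolic scaling of the heat kernel. The powers of l add up to m + 3, which is twice 1 + (m +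
    1)/2, and the factor 1/2 of [q'] raises 2^(m+1) to 2^(m+2). *)
Let gauss_kernel_q tau : tau < T ->
  gauss_kernel (q tau *: z) * q tau ^+ m * q' tau =
  expR (- (dot z z / (4 * (T - tau)))) /
    (2 ^+ m.+2 * pi `^ (m.+1%:R / 2) * (T - tau) `^ (1 + m.+1%:R / 2)).
Proof.
move=> tT; have rp := r_gt0 tT; have Tt : 0 <= T - tau by rewrite subr_ge0 ltW.
rewrite sqrt_powR ?pi_ge0// (_ : 1 + m.+1%:R / 2 = m.+3%:R / 2); last first.
  by rewrite -!natr1; field.
rewrite sqrt_powR// -/(r tau) /gauss_kernel dotZl dotZr.
rewrite (_ : q tau * (q tau * dot z z) / 4 = dot z z / (4 * (T - tau))); last first.
  by rewrite -(r_sqr tT) /q; field; rewrite gt_eqF.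
rewrite /q' /q exprVn !exprMn !exprS.
have n2 : 2 ^+ m != 0 :> R by rewrite expf_neq0// pnatr_eq0.
have npi : Num.sqrt (pi : R) != 0 by rewrite gt_eqF// sqrtr_gt0 pi_gt0.
have npim : Num.sqrt (pi : R) ^+ m != 0 by rewrite expf_neq0.
have nrm : r tau ^+ m != 0 by rewrite expf_neq0// gt_eqF.
have nr : r tau != 0 by rewrite gt_eqF.
by field; rewrite n2 npi npim nrm nr.
Qed.

Lemma heat_time_integral_le :
  (\int[@lebesgue_measure R]_(tau in `[0%R, T[)
     (expR (- (dot z z / (4 * (T - tau)))) /
      (2 ^+ m.+2 * pi `^ (m.+1%:R / 2) * (T - tau) `^ (1 + m.+1%:R / 2)))%:E <=
   \int[@lebesgue_measure R]_l
     (gauss_kernel (l *: z) * ray_weight m l * \1_(`[(Num.sqrt T)^-1, +oo[%classic : set R) l)%:E)%E.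
Proof.
pose h (l : R) := (gauss_kernel (l *: z) * ray_weight m l *
  \1_(`[(Num.sqrt T)^-1, +oo[%classic : set R) l)%:E.
have h0 l : (0 <= h l)%E.
  by rewrite lee_fin mulr_ge0// mulr_ge0 ?gauss_kernel_ge0 ?ray_weight_ge0.
have le1 : (\int[@lebesgue_measure R]_(tau in `[0%R, T[)
     (expR (- (dot z z / (4 * (T - tau)))) /
      (2 ^+ m.+2 * pi `^ (m.+1%:R / 2) * (T - tau) `^ (1 + m.+1%:R / 2)))%:E <=
    \int[@lebesgue_measure R]_(tau in `[0%R, T[) (h (q tau) * `|q' tau|%:E))%E.
  apply: le_ge0_integral => tau; rewrite /= in_itv/= => /andP[t0 tT].
    by rewrite lee_fin divr_ge0 ?expR_ge0// mulr_ge0 ?powR_ge0// mulr_ge0 ?powR_ge0.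
  have qp : 0 < q tau by rewrite invr_gt0 r_gt0.
  rewrite -EFinM lee_fin -gauss_kernel_q// /h /ray_weight !indicE.
  rewrite mem_set/= ?in_itv/= ?andbT// mul1r mem_set/= ?in_itv/= ?andbT; last first.
    by rewrite /q lef_pV2 ?posrE ?r_gt0 ?sqrtr_gt0//; apply: ler_wsqrtr; rewrite gerBl.
  by rewrite mulr1 ger0_norm// mulr_ge0// exprn_ge0// ltW.
apply: (le_trans le1).
(* The left inverse solves l = (T - tau)^(-1/2) for tau. The interval stops short of T because the
   substitution is singular there. *)
apply: (@area_inequality R q q' measurable_q _ (fun l => T - (l ^+ 2)^-1) `]-oo, T[%classic) => //.
- by apply: measurable_funM => //; exact: measurable_funX.
- apply: measurable_funB => //; apply: (measurableT_comp (@measurable_invr R)).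
  exact: measurable_funX.
- by move=> t /=; rewrite !in_itv/= => /andP[].
- move=> t /=; rewrite in_itv/= => tT; apply: cvgM; first exact: cvg_cst.
  apply: (@continuous_comp _ _ _ q (fun y => y ^+ 3)); first exact: cvg_q.
  exact: exprn_continuous.
- move=> t /=; rewrite in_itv/= => /andP[_ tT].
  by rewrite /q -exprVn invrK r_sqr// opprB addrC subrK.
- apply/measurable_EFinP; apply: measurable_funM; last exact: measurable_indic.
  apply: measurable_funM; last exact: measurable_ray_weight.
  apply: (measurableT_comp (@measurable_gauss_kernel R m.+1)).
  apply: measurable_fun_rV => k; under eq_fun do rewrite mxE.
  exact: measurable_funM.
Qed.

End heat_time_integral.

Lemma measurable_dG d (T : measurableType d) (R : realType) n
    (nu : borel_rV R n -> borel_rV R n) (x : 'rV[R]_n) (y : T -> borel_rV R n) (t : T -> R) :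
  measurable_fun setT nu -> measurable_fun setT y -> measurable_fun setT t ->
  measurable_fun setT (fun p => dG_dnu nu x (y p) (t p)).
Proof.
move=> mnu my mt.
have mxy : measurable_fun setT (fun p => (x - (y p : 'rV[R]_n) : borel_rV R n)).
  apply: measurable_fun_rV => k; under eq_fun do rewrite !mxE.
  by apply: measurable_funB => //; exact: (measurableT_comp (measurable_coord k) my).
apply: measurable_funM.
  apply: measurable_funM.
    by apply: measurable_dot => //; exact: measurableT_comp.
  apply: (measurableT_comp (@measurable_invr R)); apply: measurable_funM => //.
  exact: (measurableT_comp (measurable_powR _) mt).
apply: measurableT_comp => //; apply: measurableT_comp => //.
apply: measurable_funM; first exact: measurable_dot.
by apply: (measurableT_comp (@measurable_invr R)); exact: measurable_funM.
Qed.

(** * The strict bound on the double-layer constant *)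

Section C_bound.
Context {R : realType} {m : nat} (D : set 'rV[R]_m.+1).
Hypotheses (Dopen : open D) (Dbnd : bounded_set D) (Dconv : convex_set D)
  (DC1 : C1_boundary D) (Dne : D !=set0).
Variable S : {measure set (borel_rV R m.+1) -> \bar R}.
Hypothesis hS : surface_measure D S.
Variable nu : 'rV[R]_m.+1 -> 'rV[R]_m.+1.
Hypothesis hnu : outward_unit_normal D nu.
Variable T : R.
Hypothesis T0 : 0 < T.
Local Open Scope ereal_scope.
Notation leb := (@lebesgue_measure R).
Notation bD := (bdry D : set (borel_rV R m.+1)).

(** The value of l = (T - tau)^(-1/2) at tau = 0, the lower end of the l-integral. *)
Let c : R := (Num.sqrt T)^-1%R.

Let c0 : (0 < c)%R. Proof. by rewrite invr_gt0 sqrtr_gt0. Qed.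

(* gauge D x u >= c says that u lies outside the dilate c (D - x), the part of
   the cone whose mass is saved. *)
Let g (x v : 'rV[R]_m.+1) : \bar R := (gauss_kernel v *
  (\1_(tangent_cone D x) v * \1_[set u | (c <= gauge D x u)%R] v))%:E.

Let g0 x v : 0 <= g x v.
Proof. by rewrite lee_fin mulr_ge0 ?gauss_kernel_ge0// mulr_ge0. Qed.

Let measurable_gauge_ge x :
  measurable ([set u | (c <= gauge D x u)%R] : set (borel_rV R m.+1)).
Proof.
rewrite (_ : [set u | _] = (gauge D x : borel_rV R m.+1 -> R) @^-1` `[c, +oo[%classic).
  by rewrite -[X in measurable X]setTI; apply: measurable_gauge.
by apply/seteqP; split => u /=; rewrite in_itv/= andbT.
Qed.

Let measurable_cone x : measurable (tangent_cone D x : set (borel_rV R m.+1)).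
Proof. by apply: measurable_rV_open; exact: tangent_cone_open. Qed.

Let measurable_g x : measurable_fun setT (g x : borel_rV R m.+1 -> \bar R).
Proof.
apply/measurable_EFinP; apply: measurable_funM; first exact: measurable_gauss_kernel.
by apply: measurable_funM; exact: measurable_indic.
Qed.

Let dotBC (x y : 'rV[R]_m.+1) : (dot (x - y) (x - y) = dot (y - x) (y - x))%R.
Proof. by rewrite -(opprB y x) dotNl dotC dotNl opprK. Qed.

(** By convexity (y - x).nu(y) >= 0, so the absolute value only changes the sign of the kernel. When
    the product is 0 both sides vanish; otherwise the ray meets the cone and its gauge is l, so the
    cut-off in [g] becomes l >= [c]. *)
Let time_integral_le x y : bdry D x -> bdry D y ->
  \int[leb]_(tau in `[0%R, T]) `|dG_dnu nu x y (T - tau)|%:E <=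
  ray_integral x (g x) y * (dot (y - x) (nu y))%:E.
Proof.
move=> Bx By; have b0 := dot_nu_ge0 Dopen Dconv DC1 hnu Bx By.
pose b := dot (y - x) (nu y); pose z := (y - x)%R.
have dxy : dot (x - y) (nu y) = (- b)%R by rewrite -opprB dotNl.
move: b0; rewrite le_eqVlt => /predU1P[b0|bp].
  rewrite -b0 mule0 integral0_eq// => tau _.
  by rewrite /dG_dnu dxy /b -b0 oppr0 !mul0r normr0.
pose H tau : R := (expR (- (dot z z / (4 * (T - tau)))) /
      (2 ^+ m.+2 * pi `^ (m.+1%:R / 2) * (T - tau) `^ (1 + m.+1%:R / 2)))%R.
have H0 tau : (0 <= H tau)%R.
  by rewrite divr_ge0 ?expR_ge0// mulr_ge0 ?powR_ge0// mulr_ge0 ?powR_ge0.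
have dGE tau : `|dG_dnu nu x y (T - tau)|%R = (b * H tau)%R.
  rewrite /dG_dnu dxy dotBC -/z /H mulNr mulNr normrN ger0_norm; last first.
    rewrite mulr_ge0 ?expR_ge0// divr_ge0 ?(ltW bp)// mulr_ge0 ?powR_ge0//.
    by rewrite mulr_ge0 ?powR_ge0.
  by rewrite -mulrA; congr (_ * _)%R; rewrite mulrC.
have mH : measurable_fun setT H.
  apply: measurable_funM.
    apply: measurableT_comp => //; apply: measurableT_comp => //.
    apply: measurable_funM => //; apply: (measurableT_comp (@measurable_invr R)).
    by apply: measurable_funM => //; exact: measurable_funB.
  apply: (measurableT_comp (@measurable_invr R)); apply: measurable_funM => //.
  by apply: (measurableT_comp (measurable_powR _)); exact: measurable_funB.
apply: (@le_trans _ _ (\int[leb]_(tau in `[0%R, T[) (b%:E * (H tau)%:E))).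
  rewrite integral_mkcond [leRHS]integral_mkcond; apply: le_ge0_integral => tau _.
    by rewrite patchE; case: ifP.
  rewrite patchE; case: ifPn => [|_]; last first.
    by rewrite patchE; case: ifP => // _; apply: mule_ge0; rewrite lee_fin // ltW.
  rewrite inE/= in_itv/= => /andP[t0]; rewrite le_eqVlt => /predU1P[->|tT].
    (* At tau = T the power of 0 is 0 and its inverse is 0 by convention, so the singular endpoint
       contributes nothing. *)
    have HT : H T = 0%R.
      by rewrite /H subrr powR0 ?mulr0 ?invr0 ?mulr0// gt_eqF// addr_gt0// divr_gt0.
    rewrite dGE HT mulr0 patchE; case: ifP => //= _.
    by rewrite HT mule0.
  by rewrite dGE patchE mem_set//= in_itv/= t0.
rewrite ge0_integralZl//; last 3 first.
- by apply/measurable_EFinP; exact: measurable_funTS.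
- by move=> tau _; rewrite lee_fin.
- by rewrite lee_fin ltW.
rewrite muleC; apply: lee_wpmul2r; first by rewrite lee_fin ltW.
apply: le_trans (heat_time_integral_le z T0) _.
apply: le_ge0_integral => l _.
  by rewrite lee_fin mulr_ge0// mulr_ge0 ?gauss_kernel_ge0 ?ray_weight_ge0.
have [l0|l0] := ltP 0%R l; last first.
  rewrite /ray_weight [\1_(`]0%R, +oo[%classic) l]indicE memNset.
    by rewrite mul0r mulr0 mul0r mule0.
  by rewrite /= in_itv/= andbT ltNge l0.
have [gr _ cr] := bdry_ray Dopen Dconv DC1 hnu Bx By bp l0.
have -> : g x (l *: (y - x)) = (gauss_kernel (l *: z) * \1_(`[c, +oo[%classic : set R) l)%:E.
  rewrite /g; congr (_ * _)%:E; rewrite indicE mem_set// mul1r !indicE; congr ((nat_of_bool _)%:R).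
  by apply/idP/idP; rewrite !inE/= in_itv/= andbT gr.
by rewrite -EFinM lee_fin mulrAC.
Qed.

Let half_space_le x : bdry D x ->
  \int[lebesgue_rV R m.+1]_v (gauss_kernel v * \1_(tangent_cone D x) v)%:E <= (2^-1)%:E.
Proof.
move=> Bx; pose C := tangent_cone D x.
pose G (v : borel_rV R m.+1) : \bar R := (gauss_kernel v * \1_C v)%:E.
have G0 v : 0 <= G v by rewrite lee_fin mulr_ge0// gauss_kernel_ge0.
have mG : measurable_fun setT G.
  apply/measurable_EFinP; apply: measurable_funM; first exact: measurable_gauss_kernel.
  by apply: measurable_indic; exact: measurable_cone.
have n1 : (-1 != 0 :> R)%R by rewrite oppr_eq0 oner_eq0.
have GN : \int[lebesgue_rV R m.+1]_v G (-1 *: (v : 'rV[R]_m.+1) + 0)%R =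
    \int[lebesgue_rV R m.+1]_v G v.
  rewrite -(integral_rV_affine 0 n1 mG G0).
  by rewrite normrN1 expr1n mul1e.
have GG : \int[lebesgue_rV R m.+1]_v G v + \int[lebesgue_rV R m.+1]_v G v <= 1.
  rewrite -[X in X + _]GN -ge0_integralD//; last first.
    exact: (measurableT_comp mG (measurable_affine_rV _ _)).
  rewrite -(@integral_gauss_kernel R m.+1); apply: le_ge0_integral => v _.
    by rewrite adde_ge0.
  rewrite /G -EFinD lee_fin addr0 scaleN1r gauss_kernelN -mulrDr.
  rewrite ler_piMr ?gauss_kernel_ge0// !indicE.
  have [/set_mem Cv|_] := boolP ((- v)%R \in C); last by rewrite add0r; case: (_ \in _).
  rewrite memNset ?addr0// => CNv; exact: (tangent_coneN Dopen Dconv Bx CNv Cv).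
have I0 : 0 <= \int[lebesgue_rV R m.+1]_v G v by exact: integral_ge0.
rewrite -/G; move: GG I0; case: (\int[lebesgue_rV R m.+1]_v G v) => [a||]//.
by rewrite -EFinD !lee_fin => a1 _; lra.
Qed.

(** The volume of the dilate is (c/2)^d times that of [D], whatever x is, and boundedness of [D]
    confines all these dilates to one ball, on which the Gaussian is at least a constant [gam]. *)
Let dilate_mass_gt0 : exists2 delta : R, (0 < delta)%R & forall x, bdry D x ->
  delta%:E <= \int[lebesgue_rV R m.+1]_v (gauss_kernel v * \1_(dilate D x (c / 2)) v)%:E.
Proof.
have c2 : (0 < c / 2)%R by rewrite divr_gt0.
have a0 : ((c / 2)^-1 != 0)%R by rewrite invr_eq0 gt_eqF.
have [M DM] := closure_bounded Dbnd.
(* Bounds |v|^2 on the dilate: v is c/2 times a difference of two points of the closure, so each of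
   its m + 1 coordinates is at most (c/2)(2M) = cM in absolute value. *)
pose B : R := (m.+1%:R * (c * M) ^+ 2)%R.
pose gam : R := (((2 * Num.sqrt pi) ^+ m.+1)^-1 * expR (- (B / 4)))%R.
have gam0 : (0 < gam)%R.
  rewrite mulr_gt0 ?expR_gt0// invr_gt0 exprn_gt0// mulr_gt0// sqrtr_gt0 pi_gt0//.
have mD := measurable_rV_open Dopen.
have LD := lebesgue_rV_open_gt0 Dopen Dne.
pose e := gam%:E * (((`|(c / 2)^-1| ^+ m.+1)^-1)%:E * lebesgue_rV R m.+1 D).
have e0 : 0 < e.
  by rewrite mule_gt0 ?lte_fin// mule_gt0// lte_fin invr_gt0 exprn_gt0// normr_gt0.
(* [e] is an extended real; should it be infinite, any positive real serves. *)
have [delta d0 de] : exists2 delta : R, (0 < delta)%R & delta%:E <= e.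
  move: e0; case: (e) => [r r0||//]; first by exists r.
  by move=> _; exists 1%R => //; rewrite leey.
exists delta => // x Bx; apply: (le_trans de); rewrite /e.
have dE : dilate D x (c / 2) = [set v | D ((c / 2)^-1 *: v + x)%R].
  by apply/seteqP; split => v; rewrite /dilate /= addrC.
have mdil : measurable (dilate D x (c / 2) : set (borel_rV R m.+1)).
  by apply: measurable_rV_open; exact: dilate_open.
have nz : (`|(c / 2)^-1| ^+ m.+1 != 0)%R by rewrite expf_neq0// normr_eq0.
have -> : ((`|(c / 2)^-1| ^+ m.+1)^-1)%:E * lebesgue_rV R m.+1 D =
    lebesgue_rV R m.+1 (dilate D x (c / 2)).
  by rewrite -(lebesgue_rV_affine x a0 mD) muleA -EFinM mulVf// mul1e -dE.
rewrite -[X in lebesgue_rV R m.+1 X]setIT -integral_indic//.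
rewrite -ge0_integralZl//; last 2 first.
- by apply/measurable_EFinP; exact: measurable_indic.
- by rewrite lee_fin ltW.
apply: le_ge0_integral => v _; first by rewrite -EFinM lee_fin mulr_ge0// ltW.
rewrite -EFinM lee_fin indicE; have [/set_mem Dv|_] := boolP (v \in _); last by rewrite !mulr0.
rewrite !mulr1 /gam /gauss_kernel ler_wpM2l//.
rewrite ler_expR lerN2 ler_wpM2r ?invr_ge0//.
rewrite /dot /B -[X in (_ <= X%:R * _)%R](card_ord m.+1) mulr_natl -sumr_const.
apply: ler_sum => k _; rewrite -expr2 -(ger0_norm (sqr_ge0 _)) normrX ler_sqr ?nnegrE//.
- have le_M w j : closure D w -> (`|w 0%R j| <= M)%R.
    move=> /DM; apply: le_trans.
    by rewrite [leRHS]/Num.Def.normr/= mx_normrE; apply/bigmax_geP; right => /=; exists (ord0, j).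
  have Dv1 : D (x + (c / 2)^-1 *: v)%R := Dv.
  have := le_M _ k (subset_closure Dv1); have := le_M _ k (proj1 Bx).
  rewrite !mxE => xM pM.
  have -> : v 0%R k = (c / 2 * ((x 0%R k + (c / 2)^-1 * v 0%R k) - x 0%R k))%R.
    by rewrite (addrC (x _ _)) addrK mulrA mulfV ?mul1r// gt_eqF.
  rewrite normrM gtr0_norm// (_ : c * M = c / 2 * (M + M))%R; last by field.
  by rewrite ler_pM2l// (le_trans (ler_normB _ _))// lerD.
- rewrite mulr_ge0 ?(ltW c0)//.
  by have /DM := proj1 Bx; apply: le_trans.
Qed.

Lemma surface_sigma_finite : exists S' : {sigma_finite_measure set (borel_rV R m.+1) -> \bar R},
  (S' : set _ -> _) = S.
Proof.
apply: sigma_finite_measure_pack; exists (fun=> setT); first by rewrite bigcup_const.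
have mB := measurable_bdry D.
move=> n; split => //; rewrite -(setUv bD) measureU ?setICr//; last exact: measurableC.
have S0 : S (~` bD) = 0 by case: hS.
rewrite [X in (_ + X)%R < _]S0 addr0.
exact: (surface_measure_finite Dbnd DC1 hS).
Qed.

Let double_integral_le x : bdry D x ->
  \int[leb]_(tau in `[0%R, T]) \int[S]_(y in bD) `|dG_dnu nu x y (T - tau)|%:E <=
  \int[lebesgue_rV R m.+1]_v g x v.
Proof.
(* The values of [nu] off the boundary are arbitrary; extending by 0 gives a Borel function on all
   of R^d, hence a jointly measurable integrand for Tonelli. *)
move=> Bx; pose nu0 (y : borel_rV R m.+1) : borel_rV R m.+1 := (nu \_ (bdry D)) y.
have mnu0 : measurable_fun setT nu0.
  apply/(measurable_restrictT _ (measurable_bdry D)).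
  exact: (measurable_nu Dbnd DC1 hnu).
have [S' S'E] := surface_sigma_finite.
pose F (p : measurableTypeR R * borel_rV R m.+1) : \bar R :=
  (`|dG_dnu nu0 x p.2 (T - p.1)| * (\1_(`[0%R, T]%classic : set R) p.1 * \1_bD p.2))%:E.
have F0 p : 0 <= F p by rewrite lee_fin mulr_ge0// mulr_ge0.
have mF : measurable_fun setT F.
  apply/measurable_EFinP; apply: measurable_funM.
    apply: measurableT_comp => //; apply: measurable_dG => //.
    exact: measurable_funB.
  apply: measurable_funM.
    by apply: (measurableT_comp _ measurable_fst); exact: measurable_indic.
  apply: (measurableT_comp _ measurable_snd); apply: measurable_indic.
  exact: measurable_bdry.
have FE tau y : bdry D y -> F (tau, y) =
    `|dG_dnu nu x y (T - tau)|%:E * (\1_(`[0%R, T]%classic : set R) tau)%:E.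
  move=> By; rewrite /F /= [\1_bD y]indicE mem_set// mulr1 EFinM.
  by rewrite /dG_dnu /nu0 patchE mem_set.
have FN tau y : ~ bdry D y -> F (tau, y) = 0.
  by move=> nBy; rewrite /F /= [\1_bD y]indicE memNset// !mulr0.
apply: (@le_trans _ _ (\int[leb]_tau \int[S]_y F (tau, y))).
  rewrite integral_mkcond; apply: le_ge0_integral => tau _.
    by rewrite patchE; case: ifP => // _; exact: integral_ge0.
  rewrite patchE; case: ifPn => [/set_mem tT|_]; last exact: integral_ge0.
  rewrite integral_mkcond; apply: le_ge0_integral => y _.
    by rewrite patchE; case: ifP => // _; rewrite lee_fin.
  rewrite patchE; case: ifPn => [/set_mem By|_] //.
  by rewrite FE// indicE mem_set// mule1.
rewrite -S'E (@fubini_tonelli _ _ _ _ R leb S' F)// S'E.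
apply: le_trans (_ : \int[S]_(y in bD) (ray_integral x (g x) y * (dot (y - x) (nu y))%:E) <= _).
  rewrite [leRHS]integral_mkcond; apply: le_ge0_integral => y _; first exact: integral_ge0.
  rewrite patchE; case: ifPn => [/set_mem By|/negP nBy]; last first.
    by rewrite integral0_eq// => tau _; apply: FN => By; apply: nBy; exact: mem_set.
  apply: le_trans (time_integral_le Bx By).
  rewrite [leRHS]integral_mkcond; apply: le_ge0_integral => tau _ //.
  rewrite FE// patchE indicE; case: ifPn => _; first by rewrite mule1.
  by rewrite mule0.
apply: le_trans (cone_inequality Dopen Dbnd Dconv DC1 hS hnu Bx (measurable_g x) (g0 x)) _.
apply: le_ge0_integral => v _; first by rewrite mule_ge0// lee_fin.
by rewrite -[leRHS]mule1 lee_wpmul2l// lee_fin indicE; case: (_ \in _).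
Qed.

(** The mass of [g] and the mass of the dilate by c/2 come from disjoint parts of the cone, whose
    total mass is at most 1/2. As [delta] is the same for all x, the supremum stays below 1/2 -
    delta. *)
Lemma C_const_lt_half : C_const D nu S T < (2^-1)%:E.
Proof.
have [delta d0 dP] := dilate_mass_gt0.
apply: (@le_lt_trans _ _ (2^-1 - delta)%:E); last by rewrite lte_fin gtrBl.
apply: ub_ereal_sup => _ [x Bx <-].
apply: (le_trans (double_integral_le Bx)).
rewrite EFinB leeBrDr//; apply: le_trans (half_space_le Bx).
apply: le_trans (leeD2l _ (dP x Bx)) _; rewrite -ge0_integralD//; last 2 first.
- by move=> v _; rewrite lee_fin mulr_ge0// gauss_kernel_ge0.
- apply/measurable_EFinP; apply: measurable_funM; first exact: measurable_gauss_kernel.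
  by apply: measurable_indic; apply: measurable_rV_open; exact: dilate_open.
apply: le_ge0_integral => v _.
  by rewrite adde_ge0// lee_fin mulr_ge0// gauss_kernel_ge0.
rewrite -EFinD lee_fin -mulrDr ler_wpM2l ?gauss_kernel_ge0//.
(* Halving [c] separates the two sets: on the dilate the gauge is at most c/2, strictly below the
   threshold [c] of [g]. *)
have c2 : (0 < c / 2)%R by rewrite divr_gt0.
rewrite !indicE; have [/set_mem dv|_] := boolP (v \in dilate D x (c / 2)).
  rewrite mem_set; last by exists (c / 2)%R.
  rewrite [X in (_ * X%:R)%R](_ : _ = 0%N) ?mulr0 ?add0r//.
  apply/eqP; rewrite eqb0; apply/negP => /set_mem/= cg.
  have := le_trans cg (gauge_le c2 dv); rewrite leNgt => /negP; apply.
  by rewrite ltr_pdivrMr// ltr_pMr// ltr1n.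
by rewrite addr0 ler_piMr//; case: (_ \in _).
Qed.

End C_bound.

(** * Stability of the Euler scheme *)

(** Each of the positive and negative parts is dominated by |f|, and two nonnegative numbers bounded
    by c differ by at most c. Being free of measurability, it applies to the time integrand of the
    scheme, whose dependence on tau passes through an integral against [sigma]. *)
Lemma le_abse_ge0_integral d (T : measurableType d) (R : realType)
    (mu : {measure set T -> \bar R}) (D : set T) (f : T -> \bar R) :
  (`|\int[mu]_(x in D) f x| <= \int[mu]_(x in D) `|f x|)%E.
Proof.
rewrite integralE.
have pos : (\int[mu]_(x in D) f^\+%E x <= \int[mu]_(x in D) `|f x|)%E.
  apply: le_ge0_integral => x _; first exact: funepos_ge0.
  by rewrite funeposE ge_max lee_abs abse_ge0.
have neg : (\int[mu]_(x in D) f^\-%E x <= \int[mu]_(x in D) `|f x|)%E.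
  apply: le_ge0_integral => x _; first exact: funeneg_ge0.
  by rewrite funenegE ge_max -abseN lee_abs abse_ge0.
have pos0 : (0 <= \int[mu]_(x in D) f^\+%E x)%E by apply: integral_ge0 => x _; exact: funepos_ge0.
have neg0 : (0 <= \int[mu]_(x in D) f^\-%E x)%E by apply: integral_ge0 => x _; exact: funeneg_ge0.
move: pos neg pos0 neg0.
case: (\int[mu]_(x in D) f^\+%E x)%E => [a||]; case: (\int[mu]_(x in D) f^\-%E x)%E => [b||];
  case: (\int[mu]_(x in D) `|f x|)%E => [c||]; rewrite ?leey ?leye_eq ?leeNy_eq// => ac bc a0 b0.
rewrite -EFinB abse_EFin lee_fin; move: ac bc a0 b0; rewrite !lee_fin => ac bc a0 b0.
by rewrite ler_norml; apply/andP; split; lra.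
Qed.

Lemma sum_integral_itv_le (R : realType) (dt : R) (phi : R -> \bar R) (k : nat) :
  0 < dt -> measurable_fun setT phi -> (forall t, 0 <= phi t)%E ->
  (\sum_(j < k) \int[@lebesgue_measure R]_(t in `[(j%:R * dt)%R, (j.+1%:R * dt)%R]) phi t
   <= \int[@lebesgue_measure R]_(t in `[0%R, (k%:R * dt)%R]) phi t)%E.
Proof.
move=> dt0 mphi phi0; elim: k => [|k ih].
  by rewrite big_ord0; exact: integral_ge0.
rewrite big_ord_recr/=; apply: (le_trans (leeD2r _ ih)).
(* Removing the endpoint k dt, a null set, from the accumulated interval makes it disjoint from the
   next one. *)
rewrite -integral_itv_bndo_bndc; last exact: measurable_funTS.
have kdt : 0 <= k%:R * dt by rewrite mulr_ge0// ltW.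
have kdt1 : k%:R * dt <= k.+1%:R * dt by rewrite ler_wpM2r ?(ltW dt0)// ler_nat.
rewrite -ge0_integral_setU//=; last 2 first.
- exact: measurable_funTS.
- apply/disj_setPS => t [/=]; rewrite !in_itv/= => /andP[_ tk] /andP[kt _].
  by move: (lt_le_trans tk kt); rewrite ltxx.
rewrite integral_mkcond [leRHS]integral_mkcond; apply: le_ge0_integral => t _.
  by rewrite patchE; case: ifP.
rewrite patchE; case: ifPn => [/set_mem/= h|_]; last by rewrite patchE; case: ifP.
rewrite patchE mem_set//= in_itv/=; case: h; rewrite in_itv/= => /andP[].
  by move=> -> /ltW tk; rewrite (le_trans tk).
by move=> kt ->; rewrite (le_trans kdt).
Qed.

Section Linfty.
Context d (T : measurableType d) (R : realType) (mu : {measure set T -> \bar R}).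
Local Open Scope ereal_scope.

Lemma ae_le_Lnorm_pinfty (f : T -> R) : \forall x \ae mu, (`|f x|)%:E <= Lnorm mu +oo (EFin \o f).
Proof.
rewrite unlock; case: ifPn => [_|]; first exact: ess_sup_ge.
(* If the whole space is null, [Lnorm] is 0 by convention, while every property holds almost
   everywhere. *)
rewrite -leNgt => mu0; exists setT; split => //.
by apply/eqP; rewrite eq_le mu0 measure_ge0.
Qed.

Lemma Lnorm_pinfty_le (f : T -> R) (K : \bar R) : 0 <= K ->
  (\forall x \ae mu, (`|f x|)%:E <= K) -> Lnorm mu +oo (EFin \o f) <= K.
Proof.
move=> K0 fK; rewrite unlock; case: ifPn => // _.
exact: ereal_inf_lbound.
Qed.

End Linfty.

(** * Induction on the time step *)

Section euler.
Context {R : realType} {m : nat} (D : set 'rV[R]_m.+1).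
Hypotheses (Dbnd : bounded_set D) (DC1 : C1_boundary D).
Variable S : {measure set (borel_rV R m.+1) -> \bar R}.
Hypothesis hS : surface_measure D S.
Variable nu : 'rV[R]_m.+1 -> 'rV[R]_m.+1.
Hypothesis hnu : outward_unit_normal D nu.
Local Open Scope ereal_scope.
Notation leb := (@lebesgue_measure R).
Notation bD := (bdry D : set (borel_rV R m.+1)).

Definition surface_potential (x : 'rV[R]_m.+1) (t : R) : \bar R :=
  \int[S]_(y in bD) `|dG_dnu nu x y t|%:E.

Lemma surface_potential_ge0 x t : 0 <= surface_potential x t.
Proof. exact: integral_ge0. Qed.

Lemma measurable_dG_bdry x t :
  measurable_fun bD (fun y : borel_rV R m.+1 => dG_dnu nu x y t).
Proof.
pose nu0 (y : borel_rV R m.+1) : borel_rV R m.+1 := (nu \_ (bdry D)) y.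
have mnu0 : measurable_fun setT nu0.
  apply/(measurable_restrictT _ (measurable_bdry D)).
  exact: (measurable_nu Dbnd DC1 hnu).
apply: (@eq_measurable_fun _ _ _ _ _ (fun y : borel_rV R m.+1 => dG_dnu nu0 x y t)).
  by move=> y By; rewrite /dG_dnu /nu0 patchE By.
by apply: measurable_funTS; exact: measurable_dG.
Qed.

Lemma measurable_surface_potential x : measurable_fun setT (surface_potential x).
Proof.
pose nu0 (y : borel_rV R m.+1) : borel_rV R m.+1 := (nu \_ (bdry D)) y.
have mnu0 : measurable_fun setT nu0.
  apply/(measurable_restrictT _ (measurable_bdry D)).
  exact: (measurable_nu Dbnd DC1 hnu).
have [S' S'E] := surface_sigma_finite Dbnd DC1 hS.
pose F (p : measurableTypeR R * borel_rV R m.+1) : \bar R :=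
  (`|dG_dnu nu0 x p.2 p.1| * \1_bD p.2)%:E.
have mF : measurable_fun setT F.
  apply/measurable_EFinP; apply: measurable_funM.
    by apply: measurableT_comp => //; exact: measurable_dG.
  apply: (measurableT_comp _ measurable_snd); apply: measurable_indic.
  exact: measurable_bdry.
have F0 p : 0 <= F p by rewrite lee_fin mulr_ge0.
have := @measurable_fun_fubini_tonelli_F _ _ _ _ R S' F mF F0.
congr (measurable_fun _ _); apply/funext => t; rewrite /fubini_F.
rewrite /surface_potential [RHS]integral_mkcond -S'E; apply: eq_integral => y _.
rewrite patchE /F /= indicE; case: ifPn => [By|_]; last by rewrite mulr0.
by rewrite mulr1 /dG_dnu /nu0 patchE By.
Qed.

(** The kernel depends on the time difference only: translating by T - t carries [0, t] onto the end
    [T - t, T] of [0, T]. Hence the constant at time T controls every step n dt <= T. *)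
Lemma surface_potential_shift x (T t : R) : (0 <= t)%R -> (t <= T)%R ->
  \int[leb]_(tau in `[0%R, t]) surface_potential x (t - tau) <=
  \int[leb]_(tau in `[0%R, T]) surface_potential x (T - tau).
Proof.
move=> t0 tT; pose h := (fun tau => surface_potential x (T - tau)) \_ `[0%R, T].
have h0 tau : 0 <= h tau by rewrite /h patchE; case: ifP => // _; exact: surface_potential_ge0.
have mh : measurable_fun setT h.
  apply/(measurable_restrictT _ (measurable_itv `[0%R, T])); apply: measurable_funTS.
  apply: (measurableT_comp (measurable_surface_potential x)).
  exact: measurable_funB.
rewrite [leRHS]integral_mkcond -/h -(integral_affine (T - t) (oner_neq0 _) mh h0).
rewrite normr1 mul1e integral_mkcond; apply: le_ge0_integral => tau _.
  by rewrite patchE; case: ifP => // _; exact: surface_potential_ge0.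
rewrite patchE; case: ifPn => // /set_mem/=; rewrite in_itv/= => /andP[t0' tt].
rewrite /h patchE mem_set/=; last by rewrite in_itv/=; apply/andP; split; lra.
by rewrite (_ : T - (1 * tau + (T - t)) = t - tau)%R//; ring.
Qed.

Variables (T kappa : R) (N : nat) (dt : R) (f sigma : nat -> 'rV[R]_m.+1 -> R).
Hypothesis kappa_lt : (kappa < 2^-1)%R.
Hypothesis kappa_ge : forall x, bdry D x ->
  \int[leb]_(tau in `[0%R, T]) surface_potential x (T - tau) <= kappa%:E.
Hypotheses (dt0 : (0 < dt)%R) (NT : (N%:R * dt <= T)%R).
Variable F : R.
Hypothesis F0 : (0 <= F)%R.
Hypothesis fF : forall n, (n <= N)%N ->
  \forall x \ae S, (`|f n x| <= F)%R.
Hypothesis sol : euler_solution D nu S N dt f sigma.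

(** The fixed point of the recursion: K/2 = K kappa + F. *)
Let K : R := (F / (2^-1 - kappa))%R.

Let K0 : (0 <= K)%R.
Proof. by rewrite divr_ge0// subr_ge0 ltW. Qed.

Lemma euler_step_le x n j : (j < n)%N -> (n <= N)%N ->
  (\forall y \ae S, bdry D y -> `|sigma j y| <= K)%R ->
  `| \int[leb]_(tau in `[(j%:R * dt)%R, (j.+1%:R * dt)%R])
       \int[S]_(y in bD) (dG_dnu nu x y (n%:R * dt - tau) * sigma j y)%:E | <=
  \int[leb]_(tau in `[(j%:R * dt)%R, (j.+1%:R * dt)%R])
     (K%:E * surface_potential x (n%:R * dt - tau)).
Proof.
move=> jn nN sK; apply: (le_trans (le_abse_ge0_integral _ _ _)).
have [msigma _ _] := sol.
apply: le_ge0_integral => tau _ //; apply: (le_trans (le_abse_ge0_integral _ _ _)).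
have mdG := measurable_dG_bdry x (n%:R * dt - tau).
have mabs : measurable_fun bD (fun y : borel_rV R m.+1 => `|dG_dnu nu x y (n%:R * dt - tau)|%:E).
  by apply/measurable_EFinP; exact: measurableT_comp.
rewrite /surface_potential -ge0_integralZl//; last exact: measurable_bdry.
apply: ae_ge0_le_integral => //.
- exact: measurable_bdry.
- apply: measurableT_comp => //; apply/measurable_EFinP; apply: measurable_funM => //.
  by apply: msigma; exact: leq_trans (ltnW jn) nN.
- by move=> y _; rewrite -EFinM lee_fin mulr_ge0.
- exact: measurable_funeM.
have aeS := ae_filter_ringOfSetsType S.
apply: filterS sK => y sK By.
rewrite -EFinM abse_EFin lee_fin normrM mulrC ler_wpM2r//; exact: sK.
Qed.

(** Strong induction, because a step uses the whole history. If all earlier values are bounded by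
    [K], the scheme gives |sigma|/2 <= K kappa + F, which equals K/2. Since the complement of the
    boundary is null, statements on the boundary and almost everywhere statements are
    interchangeable. *)
Lemma euler_bound n : (n <= N)%N -> \forall x \ae S, (`|sigma n x| <= K)%R.
Proof.
have [msigma s0 sn] := sol.
have aeS := ae_filter_ringOfSetsType S.
have aeB : \forall x \ae S, bdry D x.
  exists (~` bD); split => //; last by case: hS.
  by apply: measurableC; exact: measurable_bdry.
elim/ltn_ind: n => n ih nN.
have [n0|n0] := posnP n.
  rewrite n0; move: s0 aeB; apply: filterS2 => x s0 Bx.
  by rewrite s0// normr0.
have sj : forall j, (j < n)%N -> (\forall y \ae S, bdry D y -> `|sigma j y| <= K)%R.
  move=> j jn; have := ih j jn (leq_trans (ltnW jn) nN).
  by apply: filterS => y h _.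
have nNN : (1 <= n <= N)%N by rewrite n0.
move: (sn n nNN) (fF nN) aeB; apply: filterS3 => x sx fx Bx.
have dtn0 : (0 <= n%:R * dt)%R by rewrite mulr_ge0// ltW.
have dtnT : (n%:R * dt <= T)%R.
  by apply: le_trans NT; rewrite ler_wpM2r ?(ltW dt0)// ler_nat.
have mphi : measurable_fun setT (fun tau : R => K%:E * surface_potential x (n%:R * dt - tau)).
  apply: measurable_funeM; apply: (measurableT_comp (measurable_surface_potential x)).
  exact: measurable_funB.
have phi0 tau : 0 <= K%:E * surface_potential x (n%:R * dt - tau).
  by rewrite mule_ge0 ?surface_potential_ge0 ?lee_fin.
have bound : `|(2^-1 * sigma n x)%:E| <= (K * kappa + F)%:E.
  rewrite (sx Bx); apply: (le_trans (lee_abs_sub _ _)).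
  rewrite EFinD; apply: leeD; last by rewrite abse_EFin lee_fin.
  apply: (le_trans (lee_abs_sum _ _ _)).
  apply: (@le_trans _ _ (\sum_(j < n) \int[leb]_(tau in `[(j%:R * dt)%R, (j.+1%:R * dt)%R])
     (K%:E * surface_potential x (n%:R * dt - tau)))).
    by apply: lee_sum => j _; apply: euler_step_le => //; exact: sj.
  apply: (le_trans (sum_integral_itv_le n dt0 mphi phi0)).
  rewrite ge0_integralZl//; last 2 first.
  - apply: measurable_funTS; apply: (measurableT_comp (measurable_surface_potential x)).
    exact: measurable_funB.
  - by move=> tau _; exact: surface_potential_ge0.
  rewrite [leRHS]EFinM; apply: lee_wpmul2l; first by rewrite lee_fin.
  exact: (le_trans (surface_potential_shift x dtn0 dtnT) (kappa_ge Bx)).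
move: bound; rewrite abse_EFin lee_fin normrM ger0_norm ?invr_ge0//.
have KF : (K * (2^-1 - kappa) = F)%R by rewrite /K divfK// gt_eqF// subr_gt0.
by rewrite -KF -mulrDr subrKC mulrC ler_pM2r// invr_gt0.
Qed.

End euler.
Unset Implicit Arguments.

Theorem theorem7 (R : realType) (d : nat) (hd : (2 <= d)%N)
    (D : set 'rV[R]_d) (Dne : D !=set0) (Dopen : open D) (Dbnd : bounded_set D)
    (Dconv : convex_set D) (DC1 : C1_boundary D)
    (nu : 'rV[R]_d -> 'rV[R]_d) (hnu : outward_unit_normal D nu)
    (S : {measure set (borel_rV R d) -> \bar R}) (hS : surface_measure D S)
    (T : R) (hT : 0 < T) :
  (C_const D nu S T < (2^-1)%:E)%E /\
  forall (N : nat) (dt : R) (f sigma : nat -> 'rV[R]_d -> R),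
    (1 <= N)%N -> 0 < dt -> N%:R * dt <= T ->
    (forall n, (n <= N)%N -> Linfty_on D S (f n)) ->
    {ae S, forall x, bdry D x -> f 0%N x = 0} ->
    euler_solution D nu S N dt f sigma ->
    (norm_infty S N sigma <=
       (1 / (2^-1 - fine (C_const D nu S T)))%:E * norm_infty S N f)%E.
Proof.
case: d hd D Dne Dopen Dbnd Dconv DC1 nu hnu S hS => // m _ D Dne Dopen Dbnd Dconv DC1
  nu hnu S hS.
have Clt := C_const_lt_half Dopen Dbnd Dconv DC1 Dne hS hnu hT.
split => // N dt f sigma _ dt0 NT fL _ sol.
set C := C_const D nu S T in Clt *.
(* The value -oo, a supremum over the empty set, is also covered: [fine] sends it to 0. As soon as a
   boundary point is given, C >= 0 and hence C is finite. *)
have kappa_lt : fine C < 2^-1.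
  by move: Clt; case: C => [r||]//= _; rewrite ?invr_gt0// lte_fin.
have kappa_ge x : bdry D x -> (\int[@lebesgue_measure R]_(tau in `[0%R, T])
    surface_potential D S nu x (T - tau) <= (fine C)%:E)%E.
  move=> Bx.
  have le_C : (\int[@lebesgue_measure R]_(tau in `[0%R, T])
      surface_potential D S nu x (T - tau) <= C)%E.
    by apply: ereal_sup_ubound; exists x.
  have C0 : (0 <= C)%E.
    by apply: le_trans le_C; apply: integral_ge0 => tau _; exact: surface_potential_ge0.
  by rewrite fineK// ge0_fin_numE// (lt_trans Clt)// ltry.
have F0 : (0 <= norm_infty S N f)%E by exact: bigmax_ge_id.
have Ffin : norm_infty S N f \is a fin_num.
  rewrite ge0_fin_numE//; apply: bigmax_lt => // n _.
  by have [_] := fL n (ltn_ord n).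
have fF n : (n <= N)%N -> \forall x \ae S, `|f n x| <= fine (norm_infty S N f).
  move=> nN; have := ae_le_Lnorm_pinfty S (f n).
  have aeS := ae_filter_ringOfSetsType S.
  apply: filterS => x fx; rewrite -lee_fin fineK//; apply: (le_trans fx).
  exact: (@le_bigmax _ _ _ _ (fun n : 'I_N.+1 => Lnorm S +oo (EFin \o f n)) (Ordinal (nN : (n < N.+1)%N))).
have K0 : (0 <= (1 / (2^-1 - fine C))%:E * norm_infty S N f)%E.
  by rewrite mule_ge0// lee_fin divr_ge0// subr_ge0 ltW.
apply: bigmax_le => // n _; apply: Lnorm_pinfty_le => //.
have aeS := ae_filter_ringOfSetsType S.
have := euler_bound Dbnd DC1 hS hnu kappa_lt kappa_ge dt0 NT (fine_ge0 F0) fF sol (ltn_ord n).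
apply: filterS => x; rewrite -lee_fin => /le_trans; apply.
by rewrite -[X in (_ * X)%E](fineK Ffin) -EFinM lee_fin mul1r mulrC.
Qed.
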